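(* Let $K$ be an algebraically closed field of characteristic $2$ and let $\lambda\in K\setminus\{0,1\}$. Let $C\subset\mathbb P^2$ be the smooth plane curve of degree four over $K$ given by $$(X^2+XZ)^2+(X^2+XZ)(Y^2+YZ)+(Y^2+YZ)^2+\lambda Z^4=0.$$ Then $\mathrm{Aut}(C)$ is isomorphic to the symmetric group $S_4$ of degree four. In particular, $|\mathrm{Aut}(C)|=24$.
   Context: $(X:Y:Z)$ are homogeneous coordinates on $\mathbb P^2$ over $K$. $\mathrm{Aut}(C)$ denotes the group of all automorphisms of $C$ as an algebraic curve over $K$. *)

(* Defs.v *)
From HB Require Import structures.
From mathcomp Require Import all_boot all_order all_algebra all_fingroup.
From mathcomp Require Import boolp classical_sets functions cardinality.
From mathcomp Require Import mpoly ring.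

Set Implicit Arguments.
Unset Strict Implicit.
Unset Printing Implicit Defensive.

Import GRing.Theory.
Local Open Scope ring_scope.

(* Curves are classical projective varieties over an algebraically closed field
   K, i.e. sets of K-points. *)

Section ProjectivePlane.
Variable K : closedFieldType.

(* A point of the projective plane is a line through the origin of K^3. *)
Record proj_plane := ProjPoint {
  line_of :> {vspace 'rV[K]_3};
  _ : \dim line_of == 1%N
}.

HB.instance Definition _ := [isSub for line_of].
HB.instance Definition _ := [Choice of proj_plane by <:].

(* A choice of homogeneous coordinates (X : Y : Z) of p.  Homogeneous
   polynomials are evaluated at it; their vanishing does not depend on the
   choice. *)
Definition hcoord (p : proj_plane) : 'I_3 -> K := vpick p ord0.

Definition plane_curve (F : {mpoly K[3]}) := {p : proj_plane | F.@[hcoord p] == 0}.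

Definition smooth (F : {mpoly K[3]}) : Prop :=
  forall p : plane_curve F, exists i : 'I_3, F^`M(i).@[hcoord (val p)] != 0.

(* Morphisms of projective varieties: around every point p there is a principal
   open set D(H) on which phi is (G 0 : G 1 : G 2), with the G i homogeneous of
   the same degree.  As phi q is 1-dimensional, the last equation also says that
   the G i have no common zero on D(H). *)
Definition is_regular (F F' : {mpoly K[3]})
    (phi : plane_curve F -> plane_curve F') : Prop :=
  forall p : plane_curve F,
  exists (e d : nat) (H : {mpoly K[3]}) (G : 'I_3 -> {mpoly K[3]}),
  [/\ H \is e.-homog, forall i, G i \is d.-homog, H.@[hcoord (val p)] != 0 &
      forall q : plane_curve F, H.@[hcoord (val q)] != 0 ->
        line_of (val (phi q)) = <[\row_i (G i).@[hcoord (val q)]]>%VS].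

Definition is_automorphism (F : {mpoly K[3]})
    (phi : plane_curve F -> plane_curve F) : Prop :=
  is_regular phi /\
  exists psi, [/\ is_regular psi, cancel phi psi & cancel psi phi].

Record curve_aut (F : {mpoly K[3]}) := CurveAut {
  aut_fun :> plane_curve F -> plane_curve F;
  _ : `[< is_automorphism aut_fun >]
}.

HB.instance Definition _ F := [isSub for @aut_fun F].
HB.instance Definition _ F := [Choice of curve_aut F by <:].

Lemma hcoord_neq0 (p : proj_plane) : vpick p != 0.
Proof. by rewrite vpick0 -dimv_eq0; case: p => U /= /eqP->. Qed.

Lemma line_ofE (p : proj_plane) : line_of p = <[vpick p]>%VS.
Proof.
apply/esym/eqP; rewrite eqEdim -memvE memv_pick /= dim_vline hcoord_neq0.
by case: p => U /= /eqP->.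
Qed.

Lemma meval_homogZ d (G : {mpoly K[3]}) (c : K) (v : 'I_3 -> K) :
  G \is d.-homog -> G.@[fun i => c * v i] = c ^+ d * G.@[v].
Proof.
move=> /dhomogP hG; rewrite !mevalE mulr_sumr big_seq [RHS]big_seq.
apply: eq_bigr => m /hG <-; rewrite mulrCA; congr (_ * _).
rewrite /= mdegE -prodrXr -big_split /=.
by apply: eq_bigr => i _; rewrite exprMn.
Qed.

Lemma hcoord_line (p : proj_plane) (v : 'rV[K]_3) :
  line_of p = <[v]>%VS ->
  exists2 c : K, c != 0 & hcoord p =1 fun i => c * v ord0 i.
Proof.
move=> pv; have := memv_pick p; rewrite pv => /vlineP[c vE]; exists c.
  apply: contraNneq (hcoord_neq0 p) => c0.
  by rewrite pv vE c0 scale0r.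
by move=> i; rewrite /hcoord pv vE mxE.
Qed.

Lemma comp_homog d e (P : {mpoly K[3]}) (G : 'I_3 -> {mpoly K[3]}) :
  P \is e.-homog -> (forall i, G i \is d.-homog) ->
  P \mPo [tuple G i | i < 3] \is (d * e)%N.-homog.
Proof.
move=> /dhomogP hP hG; rewrite comp_mpolyEX big_seq; apply: rpred_sum => m mP.
apply: dhomogZ; rewrite -(hP _ mP) comp_mpolyX /= mdegE big_distrr /=.
elim/big_ind2: _ => [|p a q b hp hq|i _]; first exact: dhomog1.
  exact: dhomogM.
by apply: dhomogMn; rewrite tnth_mktuple.
Qed.

Lemma meval_comp (P : {mpoly K[3]}) (G : 'I_3 -> {mpoly K[3]}) v :
  (P \mPo [tuple G i | i < 3]).@[v] = P.@[fun i => (G i).@[v]].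
Proof.
by rewrite comp_mpoly_meval; apply: meval_eq => i; rewrite tnth_mktuple.
Qed.

Lemma regular_id F : is_regular (@id (plane_curve F)).
Proof.
move=> p; exists 0%N, 1%N, 1, (fun i => 'X_i); split.
- exact: dhomog1.
- by move=> i; rewrite dhomogX /= mdeg1.
- by rewrite meval1 oner_eq0.
move=> q _; rewrite line_ofE; congr <[_]>%VS; apply/rowP => i.
by rewrite mxE mevalXU.
Qed.

Lemma regular_comp F F' F'' (g : plane_curve F' -> plane_curve F'')
    (f : plane_curve F -> plane_curve F') :
  is_regular g -> is_regular f -> is_regular (g \o f).
Proof.
move=> rg rf p; have [e [d [H [G [hH hG Hp fE]]]]] := rf p.
have [e' [d' [H' [G' [hH' hG' Hp' gE]]]]] := rg (f p).
exists (e + d * e')%N, (d * d')%N, (H * (H' \mPo [tuple G i | i < 3])),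
  (fun i => G' i \mPo [tuple G j | j < 3]).
have key q : H.@[hcoord (val q)] != 0 ->
    exists2 c : K, c != 0 & forall k (P : {mpoly K[3]}), P \is k.-homog ->
      P.@[hcoord (val (f q))]
      = c ^+ k * (P \mPo [tuple G i | i < 3]).@[hcoord (val q)].
  move=> /fE /hcoord_line[c c0 cE]; exists c => // k P hP.
  rewrite (meval_eq P cE) (meval_homogZ _ _ hP) meval_comp; congr (_ * _).
  by apply: meval_eq => i; rewrite mxE.
split.
- by apply: dhomogM => //; exact: comp_homog.
- by move=> i; exact: comp_homog.
- have [c c0 cE] := key p Hp; move: Hp'; rewrite (cE _ _ hH').
  by rewrite mevalM !mulf_eq0 !negb_or => /andP[_ ->]; rewrite Hp.
move=> q; rewrite mevalM mulf_eq0 negb_or => /andP[Hq Hq'].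
have [c c0 cE] := key q Hq.
rewrite /= gE; last by rewrite (cE _ _ hH') mulf_neq0 // expf_neq0.
set w := \row_i _; set w' := \row_i _.
have -> : w = c ^+ d' *: w' by apply/rowP => i; rewrite !mxE (cE _ _ (hG' i)).
apply/eqP; rewrite eqEsubv -!memvE memvZ ?memv_line //=.
apply/vlineP; exists (c ^+ d')^-1.
by rewrite scalerA mulVf ?scale1r // expf_neq0.
Qed.

Section AutGroup.
Variable F : {mpoly K[3]}.
Implicit Types f g : curve_aut F.

Lemma autP f : is_automorphism f.
Proof. by case: f => f /= /asboolP. Qed.

Lemma aut_inj f g : f =1 g -> f = g.
Proof. by move=> fg; apply: val_inj; apply/funext. Qed.

Definition mkaut phi (h : is_automorphism phi) : curve_aut F :=
  CurveAut (introT (asboolP _) h).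

Lemma is_aut_id : is_automorphism (@id (plane_curve F)).
Proof. by split; [|exists id; split=> //]; exact: regular_id. Qed.

Lemma is_aut_comp f g : is_automorphism (f \o g).
Proof.
have [rf [f' [rf' fK f'K]]] := autP f; have [rg [g' [rg' gK g'K]]] := autP g.
split; first exact: regular_comp.
by exists (g' \o f'); split; [exact: regular_comp|exact: can_comp|exact: can_comp].
Qed.

Definition aut_inv_fun f := projT1 (cid (autP f).2).

Lemma aut_inv_funP f :
  [/\ is_regular (aut_inv_fun f), cancel f (aut_inv_fun f)
    & cancel (aut_inv_fun f) f].
Proof. exact: projT2 (cid (autP f).2). Qed.

Lemma is_aut_inv f : is_automorphism (aut_inv_fun f).
Proof.
by have [r K1 K2] := aut_inv_funP f; split=> //; exists f; split=> //; case: (autP f).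
Qed.

Definition aut_one := mkaut is_aut_id.
Definition aut_mul f g := mkaut (is_aut_comp f g).
Definition aut_inv f := mkaut (is_aut_inv f).

Lemma aut_mulA : associative aut_mul.
Proof. by move=> f g h; apply: aut_inj. Qed.
Lemma aut_mul1 : left_id aut_one aut_mul.
Proof. by move=> f; apply: aut_inj. Qed.
Lemma aut_mulr1 : right_id aut_one aut_mul.
Proof. by move=> f; apply: aut_inj. Qed.
Lemma aut_mulV : left_inverse aut_one aut_inv aut_mul.
Proof. by move=> f; apply: aut_inj => p /=; have [_ ->] := aut_inv_funP f. Qed.
Lemma aut_mulrV : right_inverse aut_one aut_inv aut_mul.
Proof. by move=> f; apply: aut_inj => p /=; have [_ _ ->] := aut_inv_funP f. Qed.

HB.instance Definition _ :=
  isGroup.Build (curve_aut F) aut_mulA aut_mul1 aut_mulr1 aut_mulV aut_mulrV.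

End AutGroup.

Definition quartic (l : K) : {mpoly K[3]} :=
  let X := 'X_(0 : 'I_3) in let Y := 'X_(1 : 'I_3) in let Z := 'X_(2 : 'I_3) in
  (X ^+ 2 + X * Z) ^+ 2 + (X ^+ 2 + X * Z) * (Y ^+ 2 + Y * Z)
  + (Y ^+ 2 + Y * Z) ^+ 2 + l *: Z ^+ 4.

Lemma quartic_homog l : quartic l \is 4.-homog.
Proof.
have hX (i : 'I_3) : ('X_i : {mpoly K[3]}) \is 1.-homog by rewrite dhomogX /= mdeg1.
have hA (i j : 'I_3) : ('X_i ^+ 2 + 'X_i * 'X_j : {mpoly K[3]}) \is 2.-homog.
  by rewrite dhomogD ?(dhomogMn 2 (hX i)) ?(dhomogM (hX i) (hX j)).
rewrite /quartic !dhomogD ?(dhomogMn 2 (hA _ _)) ?(dhomogM (hA _ _) (hA _ _)) //.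
by rewrite dhomogZ // (dhomogMn 4 (hX _)).
Qed.

Lemma quartic_smooth l : 2%N \in [pchar K] -> l != 0 -> smooth (quartic l).
Proof.
move=> ch2 l0 [p /= pC]; set v := hcoord p in pC *.
have t0 : 2 = 0 :> K by move: ch2; rewrite inE => /andP[_ /eqP].
apply/existsP; apply: contraT => /existsPn D.
have {}D i : (mderiv i (quartic l)).@[v] = 0 by have /negPn/eqP := D i.
have v0 : exists i, v i != 0.
  have /rV0Pn[i vi] := hcoord_neq0 p; by exists i.
pose x := v (0 : 'I_3); pose y := v (1 : 'I_3); pose z := v (2 : 'I_3).
have FE : (x ^+ 2 + x * z) ^+ 2 + (x ^+ 2 + x * z) * (y ^+ 2 + y * z)
    + (y ^+ 2 + y * z) ^+ 2 + l * z ^+ 4 = 0.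
  by move/eqP: pC => <-; rewrite /quartic !(mevalD, mevalM, mevalZ, mevalXU, rmorphXn) /=.
have dX (i j : 'I_3) : (mderiv i 'X_j).@[v] = (i == j)%:R.
  rewrite mderivX mevalZ mnm1E eq_sym; case: eqP => [->|_]; last by rewrite mul0r.
  have -> : (U_(j) - U_(j))%MM = 0%MM by apply/mnmP => k; rewrite mnmBE subnn mnm0E.
  by rewrite mpolyX0 meval1 mulr1.
pose mE := (mderivD, mderivM, mderivZ, dX, mevalD, mevalM, mevalZ, mevalXU).
have DX : z * (y ^+ 2 + y * z) = 0.
  have := D (0 : 'I_3); rewrite /quartic !exprS !expr0 !mulr1 !mE /= -/x -/y -/z => <-.
  apply/eqP; rewrite -subr_eq0.
  match goal with |- is_true (?u == 0) =>
    have -> : u = 2 * (- ((x ^+ 2 + x * z) * (2 * x + z) + x * (y ^+ 2 + y * z))) by ring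
  end.
  by rewrite t0 mul0r.
have DY : z * (x ^+ 2 + x * z) = 0.
  have := D (1 : 'I_3); rewrite /quartic !exprS !expr0 !mulr1 !mE /= -/x -/y -/z => <-.
  apply/eqP; rewrite -subr_eq0.
  match goal with |- is_true (?u == 0) =>
    have -> : u = 2 * (- ((y ^+ 2 + y * z) * (2 * y + z) + y * (x ^+ 2 + x * z))) by ring
  end.
  by rewrite t0 mul0r.
have DZ : x * (y ^+ 2 + y * z) + y * (x ^+ 2 + x * z) = 0.
  have := D (2 : 'I_3); rewrite /quartic !exprS !expr0 !mulr1 !mE /= -/x -/y -/z => <-.
  apply/eqP; rewrite -subr_eq0.
  match goal with |- is_true (?u == 0) =>
    have -> : u = 2 * (- ((x ^+ 2 + x * z) * x + (y ^+ 2 + y * z) * y + 2 * l * z ^+ 3)) by ring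
  end.
  by rewrite t0 mul0r.
have z0 : z = 0.
  apply/eqP; apply: contraT => zn0.
  move: DX DY => /eqP; rewrite mulf_eq0 (negPf zn0) => /eqP B0 /eqP.
  rewrite mulf_eq0 (negPf zn0) => /eqP A0.
  move: FE; rewrite A0 B0 expr0n /= !mul0r !add0r => /eqP.
  by rewrite mulf_eq0 (negPf l0) expf_eq0 (negPf zn0).
have xy0 : x = 0 /\ y = 0.
  move: DZ FE; rewrite z0 !mulr0 !addr0 expr0n /= mulr0 addr0 => DZ FE.
  have : x * y * (x + y) = 0 by rewrite -DZ; ring.
  move/eqP; rewrite !mulf_eq0 -orbA => /or3P[] /eqP e.
  - move: FE; rewrite e expr0n /= !(expr0n, mul0r, add0r) => /eqP.
    by rewrite !expf_eq0 /= => /eqP.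
  - move: FE; rewrite e expr0n /= !(expr0n, mulr0, addr0) => /eqP.
    by rewrite !expf_eq0 /= => /eqP.
  have xE : x = - y by apply/eqP; rewrite -addr_eq0 e.
  have : y ^+ 4 = 0.
    have -> : y ^+ 4 = - (2 * y ^+ 4) + (y ^+ 4 *+ 3) by ring.
    by rewrite t0 mul0r oppr0 add0r -[RHS]FE xE; ring.
  by move/eqP; rewrite expf_eq0 /= xE => /eqP->; rewrite oppr0.
have [x0 y0] := xy0; have [i] := v0.
case: i => [[|[|[|//]]] ilt] /negP[]; apply/eqP.
- by rewrite -x0; congr v; apply: val_inj.
- by rewrite -y0; congr v; apply: val_inj.
by rewrite -z0; congr v; apply: val_inj.
Qed.

End ProjectivePlane.

(* Main.v *)
From HB Require Import structures.
Require Import Defs.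
From mathcomp Require Import all_boot all_order all_algebra all_fingroup.
From mathcomp Require Import boolp classical_sets functions cardinality.
From mathcomp Require Import separable mpoly ring.

(* In characteristic 2 the gradient of F at v is v x Fr(v), where Fr squares the
   coordinates.  Hence D = X^2 d/dX + Y^2 d/dY + Z^2 d/dZ kills F, and restricts
   to a derivation of the curve raising degrees by 1.

   If phi is given near a point by forms G = (G_0 : G_1 : G_2), then applying D
   to F(G) = 0 yields G x DG = c (G x Fr(G)) for a rational function c, which is
   regular as C is smooth and nonzero as phi has an inverse.  The vector c G does
   not depend on G; its entries are functions of degree 1 on the cone over C that
   are regular everywhere, hence linear forms.  So phi is induced by a matrix L.
   Taking G = L v gives c = 1, that is, L v x (L Fr(v) - Fr(L v)) = 0 on C; being
   of degree 3 this holds identically, so the entries of L are in F_2.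

   Comparing the values of F at points over F_2, where F is l if Z = 1 and 1 or 0
   if Z = 0, shows that L permutes the four points (a : b : 1) with a, b in F_2.
   Conversely, each permutation of these is induced by a matrix that acts on the
   pair (X^2 + XZ, Y^2 + YZ) by an element of GL_2(F_2). *)

Set Implicit Arguments.
Unset Strict Implicit.
Unset Printing Implicit Defensive.

Import GRing.Theory.
Local Open Scope ring_scope.

(** * Polynomials and the quartic form *)

Lemma even_nums_eq0 (R : comNzRingType) : 2 = 0 :> R ->
  [/\ 4 = 0 :> R, 6 = 0 :> R, 8 = 0 :> R & 12 = 0 :> R].
Proof.
move=> t0; have e (n : nat) : 2 * n%:R = 0 :> R by rewrite t0 mul0r.
by split; [rewrite -(e 2) | rewrite -(e 3) | rewrite -(e 4) | rewrite -(e 6)]; ring.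
Qed.

(* [ring] reduces coefficients only by the equations it is given, so each even
   coefficient that occurs needs its own. *)
Ltac ring2 t0 :=
  let t4 := fresh in let t6 := fresh in let t8 := fresh in let t12 := fresh in
  have [t4 t6 t8 t12] := even_nums_eq0 t0; ring: t0 t4 t6 t8 t12.

Section Ideal.
Variables (R : comNzRingType) (J : R -> Prop).
Hypotheses (JD : forall a b, J a -> J b -> J (a + b)).
Hypotheses (JM : forall a b, J b -> J (a * b)).

(** Units modulo [J] are closed under products, so the product of [s] is both a unit and zero modulo
    [J]. *)
Lemma ideal_one (s : seq R) :
  (forall a, a \in s -> exists e, J (1 - e * a)) -> J (\prod_(a <- s) a) -> J 1.
Proof.
move=> sJ Js; have J0 : J 0 by rewrite -(mul0r (\prod_(a <- s) a)); exact: JM.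
suff [e Je] : exists e, J (1 - e * \prod_(a <- s) a).
  by have := JD Je (JM e Js); rewrite subrK.
elim: s sJ {Js} => [_|a s IHs sJ].
  by exists 1; rewrite big_nil mulr1 subrr.
have [e Je] := IHs (fun b bs => sJ b (mem_behead (s := a :: s) bs)).
have [e' Je'] := sJ a (mem_head a s).
exists (e' * e); rewrite big_cons.
have -> : 1 - e' * e * (a * \prod_(b <- s) b)
    = (1 - e * \prod_(b <- s) b) + (e * \prod_(b <- s) b) * (1 - e' * a) by ring.
exact: JD Je (JM _ Je').
Qed.

End Ideal.

Section Roots.
Variable K : closedFieldType.

Lemma poly_eq0_generic (g p : {poly K}) :
  g != 0 -> (forall t, g.[t] != 0 -> p.[t] = 0) -> p = 0.
Proof.
move=> g0 gp; suff /eqP : p * g = 0 by rewrite mulf_eq0 (negPf g0) orbF => /eqP.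
apply/eqP/negPn/negP => /closed_nonrootP[t]; rewrite /root hornerM mulf_eq0 negb_or.
by case/andP=> /negP pt /gp /eqP.
Qed.

(** The Nullstellensatz in one variable. A nonzero [p] in [J] splits into linear factors, and each X
    - z is invertible modulo [J]: it divides q - q(z) for some q in [J] that does not vanish at
    z. *)
Lemma ideal_poly_one (J : {poly K} -> Prop) :
  (forall a b, J a -> J b -> J (a + b)) -> (forall a b, J b -> J (a * b)) ->
  (forall t, exists2 p, J p & p.[t] != 0) -> J 1.
Proof.
move=> JD JM Jt; have [p Jp p0] := Jt 0; have [r pE] := closed_field_poly_normal p.
have c0 : lead_coef p != 0.
  by rewrite lead_coef_eq0; apply: contraNneq p0 => ->; rewrite horner0.
apply: (@ideal_one _ _ JD JM [seq 'X - z%:P | z <- r]); last first.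
  have := JM (lead_coef p)^-1%:P _ Jp; rewrite {2}pE -mul_polyC mulrA -polyCM.
  by rewrite mulVf // mul1r big_map.
move=> _ /mapP[z _ ->]; have [q Jq qz] := Jt z.
have /factor_theorem[u qE] : root (q - q.[z]%:P) z by rewrite rootE !hornerE subrr.
exists (- (q.[z]^-1)%:P * u).
have -> : 1 - - (q.[z]^-1)%:P * u * ('X - z%:P)
    = 1 + (q.[z]^-1)%:P * (u * ('X - z%:P)) by ring.
rewrite -qE mulrBr -polyCM mulVf // addrC subrK; exact: JM.
Qed.

End Roots.

Definition qform (R : comNzRingType) (l x y z : R) : R :=
  (x ^+ 2 + x * z) ^+ 2 + (x ^+ 2 + x * z) * (y ^+ 2 + y * z)
  + (y ^+ 2 + y * z) ^+ 2 + l * z ^+ 4.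

Lemma rmorph_qform (R S : comNzRingType) (f : {rmorphism R -> S}) l x y z :
  f (qform l x y z) = qform (f l) (f x) (f y) (f z).
Proof. by rewrite /qform !(rmorphD, rmorphM, rmorphXn). Qed.

Lemma horner_qform (R : comNzRingType) (l x y z : {poly R}) t :
  (qform l x y z).[t] = qform l.[t] x.[t] y.[t] z.[t].
Proof. exact: (rmorph_qform (horner_eval t)). Qed.

Section Quartic.
Variables (K : closedFieldType) (l : K).
Hypothesis charK : 2%N \in [pchar K].

Lemma two_eq0 : 2 = 0 :> K.
Proof. by move: charK; rewrite inE => /andP[_ /eqP]. Qed.

Lemma opp2 (x : K) : - x = x.
Proof. by apply/eqP; rewrite -subr_eq0 -opprD oppr_eq0 -mulr2n -mulr_natl two_eq0 mul0r. Qed.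

Lemma eq2 (x y : K) : x + y = 0 -> x = y.
Proof. by move/eqP; rewrite addr_eq0 opp2 => /eqP. Qed.

Lemma qform_homog (c x y z : K) :
  qform l (c * x) (c * y) (c * z) = c ^+ 4 * qform l x y z.
Proof. by rewrite /qform; ring. Qed.

Definition qform_poly (R : comNzRingType) (m y z : R) : {poly R} :=
  'X^4 + ((2 * z) *: 'X^3 + ((z ^+ 2 + (y ^+ 2 + y * z)) *: 'X^2
    + ((y ^+ 2 + y * z) * z *: 'X + ((y ^+ 2 + y * z) ^+ 2 + m * z ^+ 4)%:P))).

Lemma horner_qform_poly (R : comNzRingType) (m x y z : R) :
  (qform_poly m y z).[x] = qform m x y z.
Proof.
by rewrite /qform_poly /qform !(hornerD, hornerZ, hornerXn, hornerX, hornerC); ring.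
Qed.

Lemma qform_polyE (R : comNzRingType) (m y z : R) :
  qform_poly m y z = qform m%:P 'X y%:P z%:P.
Proof. by rewrite /qform_poly /qform -!mul_polyC; ring. Qed.

Lemma size_qform_poly (R : comNzRingType) (m y z : R) : size (qform_poly m y z) = 5%N.
Proof.
rewrite size_polyDl size_polyXn //.
do 3?[apply: (leq_ltn_trans (size_polyD _ _)); rewrite gtn_max; apply/andP; split].
- by apply: (leq_ltn_trans (size_scale_leq _ _)); rewrite size_polyXn.
- by apply: (leq_ltn_trans (size_scale_leq _ _)); rewrite size_polyXn.
- by apply: (leq_ltn_trans (size_scale_leq _ _)); rewrite size_polyX.
by apply: (leq_ltn_trans (size_polyC_leq1 _)).
Qed.

Lemma monic_qform_poly (R : comNzRingType) (m y z : R) : qform_poly m y z \is monic.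
Proof.
rewrite monicE lead_coefE size_qform_poly /= /qform_poly.
by rewrite !(coefD, coefZ, coefXn, coefX, coefC) /= !mulr0 !addr0.
Qed.

(** In characteristic 2 the derivative in x is the constant z(y^2 + yz), so the polynomial is
    separable as soon as this is nonzero. *)
Lemma qform_poly_roots (y z : K) : z * (y ^+ 2 + y * z) != 0 ->
  exists r : seq K, [/\ uniq r, size r = 4%N
    & qform_poly l y z = \prod_(x <- r) ('X - x%:P)].
Proof.
move=> yz0; have [r qE] := closed_field_poly_normal (qform_poly l y z).
have {}qE : qform_poly l y z = \prod_(x <- r) ('X - x%:P).
  by rewrite {1}qE (monicP (monic_qform_poly _ _ _)) scale1r.
exists r; split=> //; last first.
  by have := size_qform_poly l y z; rewrite qE size_prod_XsubC => -[].
rewrite -separable_prod_XsubC -qE unlock.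
have t0 : 2 = 0 :> {poly K} by rewrite -[2]/(2%:R) -polyC_natr two_eq0.
have -> : (qform_poly l y z)^`() = (z * (y ^+ 2 + y * z))%:P.
  rewrite /qform_poly !derivE -!mul_polyC; apply/eqP; rewrite -subr_eq0; apply/eqP.
  by rewrite /=; ring2 t0.
by rewrite -[_%:P]mulr1 mul_polyC coprimepZr // coprimep1.
Qed.

Lemma qform_poly_van (y z : K) (p : {poly K}) :
  z * (y ^+ 2 + y * z) != 0 -> (size p <= 4)%N ->
  (forall x, qform l x y z = 0 -> p.[x] = 0) -> p = 0.
Proof.
move=> /qform_poly_roots[r [ur sr qE]] sp pr.
apply: (roots_geq_poly_eq0 _ ur); last by rewrite sr.
apply/allP => x xr; apply/eqP/pr; rewrite -horner_qform_poly qE.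
by apply/eqP; rewrite -[_ == 0]/(root _ x) root_prod_XsubC.
Qed.

End Quartic.

(** * Regular functions on an affine chart *)

Section Chart.
Variables (K : closedFieldType) (l : K).
Hypothesis charK : 2%N \in [pchar K].
Variables a b : {poly K}.
Hypothesis ab_neq0 : b * (a ^+ 2 + a * b) != 0.

(** The chart consists of the points (x : a(t) : b(t)) and has coordinate ring K[t][X]/(F). Taking
    ['X], [1] and [1], ['X] for [a], [b] gives the parts of the curve with Z nonzero and with Y
    nonzero, which cover it. By [ab_neq0], the fiber over a general t has four points. *)
Let F : {poly {poly K}} := qform_poly l%:P a b.
Let on (x t : K) := qform l x a.[t] b.[t] = 0.

Let hornerF x t : F.[x%:P].[t] = qform l x a.[t] b.[t].
Proof. by rewrite /F horner_qform_poly horner_qform !hornerC. Qed.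

Let horner2E (P : {poly {poly K}}) x t :
  P.[x%:P].[t] = (map_poly (horner_eval t) P).[x].
Proof.
by rewrite -[x in RHS](hornerC x t) -[_.[t] in RHS]/(horner_eval t _) horner_map.
Qed.

(** Over a general t, the specialization of [P] has degree at most 3 and vanishes at four points, so
    every coefficient of [P] vanishes at t. *)
Lemma chart_van (P : {poly {poly K}}) : (size P <= 4)%N ->
  (forall x t, on x t -> P.[x%:P].[t] = 0) -> P = 0.
Proof.
move=> sP vP; apply/polyP => i; rewrite coef0; apply: (poly_eq0_generic ab_neq0) => t.
rewrite !(hornerM, hornerD, hornerXn, horner_exp) => abt.
have : map_poly (horner_eval t) P = 0.
  apply: (qform_poly_van (l := l) charK abt); first exact: leq_trans (size_poly _ _) sP.
  by move=> x xt; rewrite -horner2E; exact: vP.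
by move/polyP/(_ i); rewrite coef_map coef0.
Qed.

Lemma chart_fiber (P : {poly {poly K}}) t :
  exists E, P = map_poly polyC (map_poly (horner_eval t) P) + E * ('X - t%:P)%:P.
Proof.
elim/poly_ind: P => [|P c [E PE]]; first by exists 0; rewrite !rmorph0 mul0r add0r.
have /factor_theorem[u cE] : root (c - c.[t]%:P) t by rewrite rootE !hornerE subrr.
exists (E * 'X + u%:P); rewrite 2!rmorphD /= 2!rmorphM /= !map_polyX !map_polyC /=.
rewrite {1}PE mulrDl -{1}[c](subrK c.[t]%:P) cE.
rewrite [(u * _ + _)%:P]polyCD [(u * _)%:P]polyCM /horner_eval.
by ring.
Qed.

Section Ideal.
Variable J : {poly {poly K}} -> Prop.
Hypotheses (JD : forall p q, J p -> J q -> J (p + q)).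
Hypotheses (JM : forall p q, J q -> J (p * q)).
Hypothesis JF : J F.
Hypothesis J_pt : forall x t, on x t -> exists2 p, J p & p.[x%:P].[t] != 0.

(** Modulo T - t, where T is the inner variable, [F] splits into factors X - x with (x, t) on the
    curve. Each of them is invertible modulo [J] and T - t, by an element of [J] that does not
    vanish at (x, t). *)
Lemma chart_ideal_fiber t : exists p E, J p /\ 1 = p + E * ('X - t%:P)%:P.
Proof.
pose J' q := exists p E, J p /\ q = p + E * ('X - t%:P)%:P.
have JJ' p : J p -> J' p by exists p, 0; rewrite mul0r addr0.
have J't E : J' (E * ('X - t%:P)%:P).
  by exists 0, E; rewrite add0r -(mul0r F); split=> //; exact: JM.
have J'D p q : J' p -> J' q -> J' (p + q).
  move=> [p1 [E1 [Jp1 ->]]] [p2 [E2 [Jp2 ->]]].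
  by exists (p1 + p2), (E1 + E2); split; [exact: JD | ring].
have J'M p q : J' q -> J' (p * q).
  by move=> [q1 [E1 [Jq1 ->]]]; exists (p * q1), (p * E1); split; [exact: JM | ring].
have [r fE] := closed_field_poly_normal (map_poly (horner_eval t) F).
have {}fE : map_poly (horner_eval t) F = \prod_(x <- r) ('X - x%:P).
  have /monicP mF : map_poly (horner_eval t) F \is monic.
    exact/monic_map/monic_qform_poly.
  by rewrite {1}fE mF scale1r.
have Jr : J' (\prod_(P <- [seq 'X - x%:P%:P | x <- r]) P).
  rewrite big_map; have [E FE] := chart_fiber F t.
  have -> : \prod_(x <- r) ('X - x%:P%:P) = F + (- E) * ('X - t%:P)%:P.
    rewrite {1}FE fE rmorph_prod mulNr addrK; apply: eq_bigr => x _.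
    by rewrite rmorphB /= map_polyX map_polyC.
  by apply: J'D; [apply: JJ' | apply: J't].
apply: (@ideal_one _ J' J'D J'M _ _ Jr) => _ /mapP[x xr ->].
have [] := J_pt (x := x) (t := t).
  apply/eqP; rewrite -hornerF horner2E fE -[_ == 0]/(root _ x).
  by rewrite root_prod_XsubC.
move=> p Jp; set c := _.[_] => c0.
have /factor_theorem[u pE] : root (p - p.[x%:P]%:P) x%:P.
  by rewrite rootE !hornerE subrr.
have /factor_theorem[w wE] : root (p.[x%:P] - c%:P) t.
  by rewrite rootE !hornerE subrr.
exists (- (c^-1)%:P%:P * u).
have -> : 1 - - (c^-1)%:P%:P * u * ('X - x%:P%:P)
    = (c^-1)%:P%:P * p + (- (c^-1)%:P%:P * w%:P) * ('X - t%:P)%:P.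
  have -> : p = u * ('X - x%:P%:P) + (w * ('X - t%:P))%:P + c%:P%:P.
    by rewrite -pE -wE rmorphB /= addrA subrK subrK.
  have : (c^-1)%:P%:P * c%:P%:P = 1 :> {poly {poly K}} by rewrite -!polyCM mulVf.
  set d := (c^-1)%:P%:P; set e := c%:P%:P => de.
  by rewrite -{1}de; ring.
by apply: J'D; [apply/J'M/JJ' | apply: J't].
Qed.

(* Nakayama: 1, X, X^2, X^3 generate K[t][X]/(F) over K[t], and the matrix B,
   which is the identity at t, sends them into J. *)
Lemma chart_ideal_det t : exists2 d : {poly K}, J d%:P & d.[t] != 0.
Proof.
have [p [E [Jp oneE]]] := chart_ideal_fiber t.
pose r (i : nat) := Pdiv.Ring.rmodp ('X^i * E) F.
have rE i : 'X^i * E = Pdiv.Ring.rdivp ('X^i * E) F * F + r i.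
  exact/Pdiv.RingMonic.rdivp_eq/monic_qform_poly.
have rs i : r i = \sum_(j < 4) (r i)`_j *: 'X^j.
  rewrite -poly_def; apply/polyP => j; rewrite coef_poly; case: ltnP => // jr.
  apply: nth_default; apply: leq_trans jr; rewrite -ltnS -(size_qform_poly l%:P a b).
  exact/Pdiv.Ring.ltn_rmodpN0/monic_neq0/monic_qform_poly.
pose B : 'M[{poly K}]_4 := 1%:M - ('X - t%:P) *: \matrix_(i, j) (r i)`_j.
have JB i : J (\sum_j (B i j) *: 'X^j).
  have -> : \sum_j B i j *: 'X^j = 'X^i - ('X - t%:P)%:P * r i.
    rewrite (rs i) mulr_sumr; under eq_bigr => j _ do
      rewrite !mxE scalerBl -scalerA -(mul_polyC ('X - t%:P)).
    rewrite sumrB; congr (_ - _).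
    rewrite (bigD1 i) //= eqxx scale1r big1 ?addr0 // => j ji.
    by rewrite eq_sym (negPf ji) scale0r.
  have -> : 'X^i - ('X - t%:P)%:P * r i
      = 'X^i * p + (('X - t%:P)%:P * Pdiv.Ring.rdivp ('X^i * E) F) * F.
    rewrite -[LHS](subrK ('X^i * 1)) {2}oneE.
    have -> : r i = 'X^i * E - Pdiv.Ring.rdivp ('X^i * E) F * F.
      by apply/eqP; rewrite eq_sym subr_eq [r i + _]addrC; apply/eqP/rE.
    by ring.
  by apply: JD; apply: JM.
exists (\det B); last first.
  rewrite -[_.[t]]/(horner_eval t _) -det_map_mx.
  suff -> : map_mx (horner_eval t) B = 1%:M by rewrite det1 oner_eq0.
  apply/matrixP => i j; rewrite !mxE rmorphB rmorphM /= /horner_eval !hornerE.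
  by rewrite subrr mul0r subr0; case: eqP; rewrite ?hornerE.
(* By Cramer's rule, the first row of adj(B) B writes the determinant as a combination of the
   elements of [J] given by the rows of [B]. *)
have -> : (\det B)%:P
    = \sum_i (\adj B ord0 i)%:P * (\sum_j (B i j) *: 'X^j) :> {poly {poly K}}.
  transitivity (\sum_j (\adj B *m B) ord0 j *: 'X^j : {poly {poly K}}).
    rewrite mul_adj_mx (bigD1 ord0) //= big1 ?addr0 => [|j j0].
      by rewrite !mxE eqxx expr0 alg_polyC.
    by rewrite !mxE eq_sym (negPf j0) scale0r.
  under eq_bigr => j _ do rewrite mxE scaler_suml.
  rewrite exchange_big; apply: eq_bigr => i _; rewrite mulr_sumr; apply: eq_bigr => j _.
  by rewrite mul_polyC scalerA.
elim/big_ind: _ => [||i _]; [by rewrite -(mul0r F); exact: JM | exact: JD | exact: JM].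
Qed.

Lemma chart_ideal_one : J 1.
Proof.
apply: (ideal_poly_one (J := fun d => J d%:P)) => [p q Jp Jq|p q Jq|t].
- by rewrite polyCD; exact: JD.
- by rewrite polyCM; exact: JM.
exact: chart_ideal_det.
Qed.

End Ideal.

(** The denominators of [f], that is, the [M] for which f M is a polynomial function on the chart,
    form an ideal that contains [F] and has no common zero on the chart. So 1 is a denominator, and
    reduction modulo the monic [F] brings the degree in X below 4. *)
Lemma chart_regular (f : K -> K -> K) :
  (forall x t, on x t -> exists M N : {poly {poly K}}, M.[x%:P].[t] != 0 /\
    forall x' t', on x' t' -> f x' t' * M.[x'%:P].[t'] = N.[x'%:P].[t']) ->
  exists2 A : {poly {poly K}}, (size A <= 4)%N &
    forall x t, on x t -> f x t = A.[x%:P].[t].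
Proof.
move=> f_loc.
pose J M := exists N : {poly {poly K}},
  forall x t, on x t -> f x t * M.[x%:P].[t] = N.[x%:P].[t].
have [||||N fN] := @chart_ideal_one J.
- move=> p q [P fP] [Q fQ]; exists (P + Q) => x t xt.
  by rewrite !hornerD mulrDr fP ?fQ.
- move=> p q [Q fQ]; exists (p * Q) => x t xt.
  by rewrite !hornerM mulrCA fQ.
- by exists 0 => x t xt; rewrite hornerF xt mulr0 !hornerE.
- by move=> x t /f_loc[M [N [Mxt fM]]]; exists M => //; exists N.
exists (Pdiv.Ring.rmodp N F).
  rewrite -ltnS -(size_qform_poly l%:P a b).
  exact/Pdiv.Ring.ltn_rmodpN0/monic_neq0/monic_qform_poly.
move=> x t xt; have := fN x t xt; rewrite !hornerC mulr1 => ->.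
rewrite {1}(Pdiv.RingMonic.rdivp_eq (monic_qform_poly l%:P a b : F \is monic) N).
by rewrite !hornerD !hornerM hornerF xt mulr0 add0r.
Qed.

End Chart.

(** * Directional derivatives of forms *)

Lemma mpoly_ring_ind n (R : comNzRingType) (P : {mpoly R[n]} -> Prop) :
  (forall c, P c%:MP) -> (forall i, P 'X_i) ->
  (forall A B, P A -> P B -> P (A + B)) -> (forall A B, P A -> P B -> P (A * B)) ->
  forall A, P A.
Proof.
move=> PC PX PD PM; elim/mpolyind => [|c m A _ _ PA]; first exact: PC 0.
apply: PD => //; rewrite -mul_mpolyC; apply: (PM) => //; rewrite mpolyXE_id.
elim/big_ind: _ => [|B B' ? ?|i _]; [exact: (PC 1) | exact: PM |].
by elim: (m i) => [|k IHk]; rewrite ?expr0 ?exprS; [exact: (PC 1) | exact: PM].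
Qed.

Lemma meval_mderivXU n (R : comNzRingType) (i j : 'I_n) v :
  ('X_j^`M(i) : {mpoly R[n]}).@[v] = (i == j)%:R.
Proof.
rewrite mderivX mevalZ mnm1E eq_sym; case: eqP => [->|_]; last by rewrite mul0r.
have -> : (U_(j) - U_(j))%MM = 0%MM by apply/mnmP => k; rewrite mnmBE subnn mnm0E.
by rewrite mpolyX0 meval1 mulr1.
Qed.

Section Derivative.
Variables (n : nat) (K : fieldType).
Implicit Types (A B : {mpoly K[n]}) (v w : 'I_n -> K).

Definition ddir A v w : K := \sum_i A^`M(i).@[v] * w i.

Lemma ddirC c v w : ddir c%:MP v w = 0.
Proof. by rewrite /ddir big1 // => i _; rewrite mderivC meval0 mul0r. Qed.

Lemma ddirX i v w : ddir 'X_i v w = w i.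
Proof.
rewrite /ddir (bigD1 i) //= meval_mderivXU eqxx mul1r big1 ?addr0 // => j ji.
by rewrite meval_mderivXU (negPf ji) mul0r.
Qed.

Lemma ddirD A B v w : ddir (A + B) v w = ddir A v w + ddir B v w.
Proof.
by rewrite /ddir -big_split; apply: eq_bigr => i _; rewrite mderivD mevalD mulrDl.
Qed.

Lemma ddirM A B v w : ddir (A * B) v w = ddir A v w * B.@[v] + A.@[v] * ddir B v w.
Proof.
rewrite /ddir mulr_suml mulr_sumr -big_split; apply: eq_bigr => i _ /=.
by rewrite mderivM mevalD !mevalM; ring.
Qed.

Lemma ddirN A v w : ddir (- A) v w = - ddir A v w.
Proof.
by rewrite /ddir -sumrN; apply: eq_bigr => i _; rewrite mderivN mevalN mulNr.
Qed.

Lemma ddirB A B v w : ddir (A - B) v w = ddir A v w - ddir B v w.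
Proof. by rewrite ddirD ddirN. Qed.

Lemma ddir_euler d A v : A \is d.-homog -> ddir A v v = d%:R * A.@[v].
Proof.
move=> /dhomogP hA.
have mE m : ddir 'X_[m] v v = (mdeg m)%:R * ('X_[K, m]).@[v].
  rewrite mdegE natr_sum mulr_suml; apply: eq_bigr => i _.
  rewrite mderivX mevalZ -mulrA -(mevalXU v i) -mevalM -mpolyXD.
  case: (posnP (m i)) => [-> | mi]; first by rewrite !mul0r.
  by rewrite submK // lep1mP -lt0n.
rewrite (mpolyE A) big_seq; elim/big_ind: _ => [|B C IB IC|m /hA mA].
- by rewrite meval0 mulr0 -(ddirC 0 v v) mpolyC0.
- by rewrite ddirD IB IC mevalD mulrDr.
by rewrite -mul_mpolyC ddirM ddirC mE mA !mevalM mul0r add0r mevalC mulrCA.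
Qed.

Lemma ddir_comp k (P : {mpoly K[k]}) (G : k.-tuple {mpoly K[n]}) v w :
  ddir (P \mPo G) v w
  = \sum_i P^`M(i).@[fun j => (tnth G j).@[v]] * ddir (tnth G i) v w.
Proof.
elim/mpoly_ring_ind: P => [c|i|A B IA IB|A B IA IB].
- rewrite comp_mpolyC ddirC big1 // => i _; by rewrite mderivC meval0 mul0r.
- rewrite comp_mpolyXU -tnth_nth (bigD1 i) //= meval_mderivXU eqxx mul1r.
  rewrite big1 ?addr0 // => j ji.
  by rewrite meval_mderivXU (negPf ji) mul0r.
- rewrite comp_mpolyD ddirD IA IB -big_split; apply: eq_bigr => i _.
  by rewrite mderivD mevalD mulrDl.
rewrite rmorphM ddirM IA IB mulr_suml mulr_sumr -big_split; apply: eq_bigr => i _.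
rewrite mderivM mevalD !mevalM /= !comp_mpoly_meval.
by ring.
Qed.

End Derivative.

(** * Forms vanishing on the curve *)

Definition vec3 (R : Type) (x y z : R) : 'I_3 -> R := fun i => nth x [:: x; y; z] i.

Lemma ord3P (P : 'I_3 -> Prop) : P 0 -> P 1 -> P 2 -> forall i, P i.
Proof.
move=> P0 P1 P2; case=> [[|[|[|//]]] i3].
- by congr P: P0; apply: val_inj.
- by congr P: P1; apply: val_inj.
by congr P: P2; apply: val_inj.
Qed.

Lemma sum3 (R : nmodType) (f : 'I_3 -> R) : \sum_i f i = f 0 + f 1 + f 2.
Proof.
rewrite !big_ord_recl big_ord0 addr0 addrA; congr (f _ + f _ + f _); exact: val_inj.
Qed.

Definition cross (R : pzRingType) (u w : 'I_3 -> R) : 'I_3 -> R :=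
  vec3 (u 1 * w 2 - u 2 * w 1) (u 2 * w 0 - u 0 * w 2) (u 0 * w 1 - u 1 * w 0).

Lemma cross_dotl (R : comNzRingType) (u w : 'I_3 -> R) : \sum_i cross u w i * u i = 0.
Proof. by rewrite sum3 /cross /vec3 /=; ring. Qed.

Lemma cross_dotr (R : comNzRingType) (u w : 'I_3 -> R) : \sum_i cross u w i * w i = 0.
Proof. by rewrite sum3 /cross /vec3 /=; ring. Qed.

Section Quartic.
Variables (K : closedFieldType) (l : K).
Hypothesis charK : 2%N \in [pchar K].

Local Notation T := {mpoly K[3]}.
Local Notation F := (quartic l).

Lemma quarticE (v : 'I_3 -> K) : F.@[v] = qform l (v 0) (v 1) (v 2).
Proof. by rewrite /quartic !(mevalD, mevalM, mevalZ, mevalXU, rmorphXn). Qed.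

(* [iota3] identifies K[Z][Y][X], where X is the outermost variable, with K[X, Y, Z]. *)
Definition iota1 : {rmorphism {poly K} -> T} :=
  GRing.RMorphism.clone _ _ (horner_eval 'X_2 \o map_poly (@mpolyC 3 K)) _.
Definition iota2 : {rmorphism {poly {poly K}} -> T} :=
  GRing.RMorphism.clone _ _ (horner_eval 'X_1 \o map_poly iota1) _.
Definition iota3 : {rmorphism {poly {poly {poly K}}} -> T} :=
  GRing.RMorphism.clone _ _ (horner_eval 'X_0 \o map_poly iota2) _.

Definition eval2 (y z : K) : {rmorphism {poly {poly K}} -> K} :=
  GRing.RMorphism.clone _ _ (horner_eval y \o map_poly (horner_eval z)) _.

Lemma meval_horner_map (R : comNzRingType) (f : {rmorphism R -> T})
    (e : {rmorphism R -> K}) (p : {poly R}) i v :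
  (forall r, (f r).@[v] = e r) ->
  ((map_poly f p).['X_i]).@[v] = (map_poly e p).[v i].
Proof.
move=> fe; rewrite -[LHS]horner_map /= mevalXU -map_poly_comp /=.
by congr (_.[_]); apply: eq_map_poly.
Qed.

Lemma meval_iota1 p v : (iota1 p).@[v] = p.[v 2].
Proof.
rewrite /= /horner_eval (meval_horner_map (e := idfun)) => [|r]; last exact: mevalC.
by rewrite map_poly_id.
Qed.

Lemma meval_iota2 p v : (iota2 p).@[v] = eval2 (v 1) (v 2) p.
Proof. by apply: meval_horner_map => r; exact: meval_iota1. Qed.

Lemma meval_iota3 p v : (iota3 p).@[v] = (map_poly (eval2 (v 1) (v 2)) p).[v 0].
Proof. by apply: meval_horner_map => r; exact: meval_iota2. Qed.

Lemma iota1X : iota1 'X = 'X_2.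
Proof. by rewrite /= /horner_eval map_polyX hornerX. Qed.

Lemma iota2C p : iota2 p%:P = iota1 p.
Proof. by rewrite -[LHS]/((map_poly iota1 p%:P).['X_1]) map_polyC hornerC. Qed.

Lemma iota2X : iota2 'X = 'X_1.
Proof. by rewrite -[LHS]/((map_poly iota1 'X).['X_1]) map_polyX hornerX. Qed.

Lemma iota3C p : iota3 p%:P = iota2 p.
Proof. by rewrite -[LHS]/((map_poly iota2 p%:P).['X_0]) map_polyC hornerC. Qed.

Lemma iota3X : iota3 'X = 'X_0.
Proof. by rewrite -[LHS]/((map_poly iota2 'X).['X_0]) map_polyX hornerX. Qed.

Lemma iota1C c : iota1 c%:P = c%:MP.
Proof. by rewrite /= /horner_eval map_polyC hornerC. Qed.

Lemma iota3_surj (A : T) : exists P, A = iota3 P.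
Proof.
elim/mpoly_ring_ind: A => [c|i|A B [P ->] [Q ->]|A B [P ->] [Q ->]].
- by exists c%:P%:P%:P; rewrite iota3C iota2C iota1C.
- elim/ord3P: i; [exists 'X | exists 'X%:P | exists 'X%:P%:P].
  + by rewrite iota3X.
  + by rewrite iota3C iota2X.
  by rewrite iota3C iota2C iota1X.
- by exists (P + Q); rewrite rmorphD.
by exists (P * Q); rewrite rmorphM.
Qed.

Lemma eval2_eq0 (p : {poly {poly K}}) :
  (forall y z, z * (y ^+ 2 + y * z) != 0 -> eval2 y z p = 0) -> p = 0.
Proof.
move=> p0; apply/polyP => i; rewrite coef0; apply: (@poly_eq0_generic _ 'X) => [|z].
  by rewrite polyX_eq0.
rewrite hornerX => z0.
have : map_poly (horner_eval z) p = 0.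
  apply: (@poly_eq0_generic _ ('X^2 + z *: 'X)) => [|y].
    by rewrite -size_poly_eq0 size_polyDl size_polyXn // size_scale ?size_polyX.
  rewrite hornerD hornerXn hornerZ hornerX mulrC => yz.
  by apply: (p0 y z); rewrite mulf_neq0 // [y * z]mulrC.
by move/polyP/(_ i); rewrite coef_map coef0.
Qed.

(** The quartic form is monic of degree 4 in X. The remainder of a division by it has degree at most
    3 in X and vanishes at four values of X for general Y and Z, so it is zero. *)
Lemma vanish_dvd (A : T) :
  (forall v, v 2 != 0 -> F.@[v] = 0 -> A.@[v] = 0) -> exists Q, A = Q * F.
Proof.
have [P ->] := iota3_surj A => vP.
pose F3 : {poly {poly {poly K}}} := qform_poly l%:P%:P 'X 'X%:P.
have mF : F3 \is monic := monic_qform_poly _ _ _.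
have F3E : iota3 F3 = F.
  rewrite /F3 qform_polyE rmorph_qform !(iota3X, iota3C, iota2X, iota2C, iota1X, iota1C).
  by rewrite /qform /quartic mul_mpolyC.
exists (iota3 (Pdiv.Ring.rdivp P F3)).
rewrite {1}(Pdiv.RingMonic.rdivp_eq mF P) rmorphD rmorphM F3E.
set Q := Pdiv.CommonRing.rmodp P F3; suff -> : Q = 0 by rewrite rmorph0 addr0.
have sQ : (size Q <= 4)%N.
  rewrite -ltnS -(size_qform_poly (l%:P%:P : {poly {poly K}}) 'X 'X%:P).
  exact/Pdiv.Ring.ltn_rmodpN0/monic_neq0.
apply/polyP => i; rewrite coef0; apply: eval2_eq0 => y z yz.
have : map_poly (eval2 y z) Q = 0.
  apply: (qform_poly_van (l := l) charK yz); first exact: leq_trans (size_poly _ _) sQ.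
  move=> x xyz; pose v := vec3 x y z.
  have Fv : F.@[v] = 0 by rewrite quarticE.
  have := vP v _ Fv; rewrite (Pdiv.RingMonic.rdivp_eq mF P) rmorphD rmorphM F3E.
  rewrite mevalD mevalM Fv mulr0 add0r meval_iota3; apply.
  by apply: contraNneq yz => z0; rewrite -[z]/(v 2) z0 mul0r.
by move/polyP/(_ i); rewrite coef_map coef0.
Qed.

Definition frob (v : 'I_3 -> K) : 'I_3 -> K := fun i => v i ^+ 2.

Lemma gradient_quartic v i : F^`M(i).@[v] = cross v (frob v) i.
Proof.
have t0 := two_eq0 charK.
rewrite /quartic !exprS !expr0 !mulr1.
rewrite !(mderivD, mderivM, mderivZ, mevalD, mevalM, mevalZ, mevalXU, meval_mderivXU).
elim/ord3P: i; rewrite /cross /frob /vec3 /=; apply: eq2 => //; ring2 t0.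
Qed.

Lemma ddir_quartic v w : ddir F v w = \sum_i cross v (frob v) i * w i.
Proof. by apply: eq_bigr => i _; rewrite gradient_quartic. Qed.

(** By [vanish_dvd], [A] is a multiple of the quartic form, and D kills that form as v x Fr(v) is
    orthogonal to Fr(v). The point at which D A is taken may lie on Z = 0. *)
Lemma vanish_ddir (A : T) v : (forall v, v 2 != 0 -> F.@[v] = 0 -> A.@[v] = 0) ->
  F.@[v] = 0 -> ddir A v (frob v) = 0.
Proof.
move=> /vanish_dvd[Q ->] Fv.
by rewrite ddirM Fv mulr0 add0r ddir_quartic cross_dotr mulr0.
Qed.

End Quartic.

(** * Local representations of a morphism *)

Section Vectors.
Variable K : fieldType.
Implicit Types (u v w : 'I_3 -> K) (c : K).

Definition nonzero v := exists i, v i != 0.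

Lemma nonzeroZ c v : c != 0 -> nonzero v -> nonzero (fun i => c * v i).
Proof. by move=> c0 [i vi]; exists i; rewrite mulf_neq0. Qed.

Lemma nonzero2 v : v 2 != 0 -> nonzero v. Proof. by exists 2. Qed.

Lemma eq_cross (R : pzRingType) (u u' w w' : 'I_3 -> R) :
  u =1 u' -> w =1 w' -> cross u w =1 cross u' w'.
Proof. by move=> uu ww i; rewrite /cross !uu !ww. Qed.

Lemma crossZl c u w k : cross (fun i => c * u i) w k = c * cross u w k.
Proof. by elim/ord3P: k; rewrite /cross /vec3 /=; ring. Qed.

Lemma crossZr c u w k : cross u (fun i => c * w i) k = c * cross u w k.
Proof. by elim/ord3P: k; rewrite /cross /vec3 /=; ring. Qed.

Lemma crossvv u k : cross u u k = 0.
Proof. by elim/ord3P: k; rewrite /cross /vec3 /=; ring. Qed.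

Lemma crossC u w k : cross u w k = - cross w u k.
Proof. by elim/ord3P: k; rewrite /cross /vec3 /=; ring. Qed.

Lemma cross_cross n u w k :
  cross n (cross u w) k = u k * (\sum_i n i * w i) - w k * (\sum_i n i * u i).
Proof. by rewrite !sum3; elim/ord3P: k; rewrite /cross /vec3 /=; ring. Qed.

Lemma cross_eq0 u w : nonzero u -> (forall k, cross u w k = 0) ->
  exists c, forall i, w i = c * u i.
Proof.
move=> [i ui] uw; exists (w i / u i) => k.
have : cross (fun j => (i == j)%:R) (cross u w) k = 0.
  rewrite (eq_cross (frefl _) uw).
  by elim/ord3P: k; rewrite /cross /vec3 /= !mulr0 subrr.
rewrite cross_cross (bigD1 i) //= big1 => [|j ji]; last by rewrite eq_sym (negPf ji) mul0r.
rewrite (bigD1 i) //= big1 => [|j ji]; last by rewrite eq_sym (negPf ji) mul0r.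
rewrite eqxx !mul1r !addr0 => /eqP; rewrite subr_eq0 => /eqP e.
by apply: (mulIf ui); rewrite -e mulrAC divfK // mulrC.
Qed.

Lemma vlineZ c (v : 'rV[K]_3) : c != 0 -> (<[c *: v]> = <[v]>)%VS.
Proof.
move=> c0; apply/eqP; rewrite eqEsubv -!memvE memvZ ?memv_line //=.
by apply/vlineP; exists c^-1; rewrite scalerA mulVf ?scale1r.
Qed.

Lemma vline_row_inj u w : nonzero u ->
  (<[\row_i u i]> = <[\row_i w i]>)%VS -> exists2 c, c != 0 & forall i, u i = c * w i.
Proof.
move=> [i ui] uw; have : \row_i u i \in <[\row_i w i]>%VS by rewrite -uw memv_line.
case/vlineP=> c cE; have e j : u j = c * w j by move/rowP/(_ j): cE; rewrite !mxE.
by exists c => //; apply: contraNneq ui => c0; rewrite e c0 mul0r.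
Qed.

End Vectors.

Section Rep.
Variables (K : closedFieldType) (l : K).
Hypothesis charK : 2%N \in [pchar K].
Hypothesis l_neq0 : l != 0.

Local Notation T := {mpoly K[3]}.
Local Notation F := (quartic l).
Local Notation C := (plane_curve F).

Definition on_cone (v : 'I_3 -> K) := nonzero v /\ F.@[v] = 0.

Lemma on_coneZ c v : c != 0 -> on_cone v -> on_cone (fun i => c * v i).
Proof.
move=> c0 [v0 Fv]; split; first exact: nonzeroZ.
by rewrite (meval_homogZ _ _ (quartic_homog l)) Fv mulr0.
Qed.

Lemma on_cone_hcoord (p : C) : on_cone (hcoord (val p)).
Proof.
split; last exact/eqP/(valP p).
by have /rV0Pn[i vi] := hcoord_neq0 (val p); exists i.
Qed.

Lemma cone_point v : on_cone v -> exists p : C, line_of (val p) = <[\row_i v i]>%VS.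
Proof.
move=> [[i vi] Fv].
have dv : \dim <[\row_i v i]> == 1%N.
  rewrite dim_vline; suff -> : \row_i v i != 0 by [].
  by apply/rV0Pn; exists i; rewrite mxE.
pose p := ProjPoint dv.
have pF : F.@[hcoord p] == 0.
  have [c c0 pv] := hcoord_line (erefl : line_of p = <[\row_i v i]>%VS).
  rewrite (meval_eq _ pv) (meval_homogZ _ _ (quartic_homog l)).
  by rewrite (meval_eq (v2 := v)) ?Fv ?mulr0 // => j; rewrite mxE.
by exists (exist _ p pF).
Qed.

Lemma point_coord (p : C) v : line_of (val p) = <[\row_i v i]>%VS ->
  exists2 c, c != 0 & forall i, hcoord (val p) i = c * v i.
Proof. by move=> /hcoord_line[c c0 pv]; exists c => // i; rewrite pv mxE. Qed.

Lemma point_on_cone (p : C) v : line_of (val p) = <[\row_i v i]>%VS -> on_cone v.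
Proof.
move=> /point_coord[c c0 pv]; have [[i pi] Fp] := on_cone_hcoord p; split.
  by exists i; apply: contraNneq pi => vi; rewrite pv vi mulr0.
move: Fp; rewrite (meval_eq _ pv) (meval_homogZ _ _ (quartic_homog l)) => /eqP.
by rewrite mulf_eq0 expf_eq0 (negPf c0) /= => /eqP.
Qed.

Lemma smooth_cone v : on_cone v -> exists k, cross v (frob v) k != 0.
Proof.
move=> /cone_point[p pv]; have [c c0 hv] := point_coord pv.
have [k] := quartic_smooth charK l_neq0 p; rewrite gradient_quartic //.
have -> : cross (hcoord (val p)) (frob (hcoord (val p))) k
    = c * (c ^+ 2 * cross v (frob v) k).
  rewrite -crossZr -crossZl; apply: eq_cross => // i.
  by rewrite /frob hv exprMn.
by rewrite !mulf_eq0 !negb_or => /and3P[_ _ vk]; exists k.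
Qed.

Definition dG (G : 'I_3 -> T) v i := ddir (G i) v (frob v).

Local Notation "G @@ v" := (fun i => (G i).@[v]) (at level 30).

Section Representation.
Variable phi : C -> C.

Definition rep e d (H : T) (G : 'I_3 -> T) :=
  [/\ H \is e.-homog, forall i, G i \is d.-homog &
      forall q : C, H.@[hcoord (val q)] != 0 ->
        line_of (val (phi q)) = <[\row_i (G i).@[hcoord (val q)]]>%VS].

Variables (e d : nat) (H : T) (G : 'I_3 -> T).
Hypothesis rG : rep e d H G.

Lemma rep_line v (p : C) : line_of (val p) = <[\row_i v i]>%VS -> H.@[v] != 0 ->
  line_of (val (phi p)) = <[\row_i (G i).@[v]]>%VS.
Proof.
have [hH hG phiE] := rG.
move=> /point_coord[c c0 pv] Hv; rewrite phiE; last first.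
  by rewrite (meval_eq _ pv) (meval_homogZ _ _ hH) mulf_neq0 // expf_neq0.
rewrite -[RHS](@vlineZ K (c ^+ d)) ?expf_neq0 //; congr <[_]>%VS; apply/rowP => i.
by rewrite !mxE (meval_eq _ pv) (meval_homogZ _ _ (hG i)).
Qed.

Lemma rep_on_cone v : on_cone v -> H.@[v] != 0 -> on_cone (G @@ v).
Proof. by move=> /cone_point[p pv] Hv; exact: point_on_cone (rep_line pv Hv). Qed.

(* D G is [c] times Fr(G) modulo G at [v]. *)
Definition slope v c := forall k, cross (G @@ v) (dG G v) k
  = c * cross (G @@ v) (frob (G @@ v)) k.

(** Let n = g x Fr(g) be the gradient of F at g = G(v). Applying D to F(G) = 0 gives n . DG = 0, and
    n . g = 0 as well, so n x (g x DG) = 0. As n is nonzero by smoothness, g x DG is a multiple of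
    n. *)
Lemma slopeP v : on_cone v -> H.@[v] != 0 -> exists c, slope v c.
Proof.
move=> cv Hv; have [g0 Fg] := rep_on_cone cv Hv.
set g := G @@ v in g0 Fg *; set n := cross g (frob g).
have [k nk] : nonzero n := smooth_cone (conj g0 Fg).
(* F(G) is only known to vanish where [H] does not. The factor [H] makes the product vanish on the
   whole curve, and it is nonzero at [v]. *)
pose A := (F \mPo [tuple G i | i < 3]) * H.
have AE w : A.@[w] = F.@[G @@ w] * H.@[w] by rewrite mevalM meval_comp.
have : ddir A v (frob v) = 0.
  apply: (vanish_ddir (l := l) charK) => [w /nonzero2 w0 Fw|]; last by case: cv.
  rewrite AE; have [->|Hw] := eqVneq H.@[w] 0; first by rewrite mulr0.
  by have [_ ->] := rep_on_cone (conj w0 Fw) Hw; rewrite mul0r.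
rewrite ddirM meval_comp Fg mul0r addr0 => /eqP.
rewrite mulf_eq0 (negPf Hv) orbF ddir_comp => /eqP ng'.
have {}ng' : \sum_i n i * dG G v i = 0.
  rewrite -[RHS]ng'; apply: eq_bigr => i _; rewrite /n -(gradient_quartic l charK).
  by rewrite tnth_mktuple; congr (_ * _); apply: meval_eq => j; rewrite tnth_mktuple.
have [|c cE] := @cross_eq0 _ n (cross g (dG G v)) (ex_intro _ k nk); last by exists c.
by move=> j; rewrite cross_cross ng' cross_dotl !mulr0 subrr.
Qed.

End Representation.

Lemma cross_meval (G G' : 'I_3 -> T) v k :
  (cross G G' k).@[v] = cross (G @@ v) (G' @@ v) k.
Proof. by elim/ord3P: k; rewrite /cross /vec3 /= mevalB !mevalM. Qed.

Lemma ddir_cross (G G' : 'I_3 -> T) v w k :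
  ddir (cross G G' k) v w = cross (fun i => ddir (G i) v w) (G' @@ v) k
    + cross (G @@ v) (fun i => ddir (G' i) v w) k.
Proof. by elim/ord3P: k; rewrite /cross /vec3 /= ddirB !ddirM; ring. Qed.

(** On the curve G' = r G, but r is only a scalar chosen at each point, so D is applied to G x G' =
    0 instead. At [v] this yields G x DG' = r (G x DG), and the two slope equations then give c' r^3
    = c r^2. *)
Lemma slope_uniq phi e d H G e' d' H' G' v c c' :
  rep phi e d H G -> rep phi e' d' H' G' -> on_cone v -> H.@[v] != 0 -> H'.@[v] != 0 ->
  slope G v c -> slope G' v c' -> forall i, c' * (G' i).@[v] = c * (G i).@[v].
Proof.
move=> rG rG' cv Hv Hv' sc sc'.
have prop w : on_cone w -> H.@[w] != 0 -> H'.@[w] != 0 ->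
    exists2 r, r != 0 & forall i, (G' i).@[w] = r * (G i).@[w].
  move=> cw Hw Hw'; have [p pw] := cone_point cw.
  apply: vline_row_inj; first by case: (rep_on_cone rG' cw Hw').
  by rewrite -(rep_line rG pw Hw) -(rep_line rG' pw Hw').
have [r r0 rE] := prop v cv Hv Hv'.
have dE k : cross (dG G v) (G' @@ v) k + cross (G @@ v) (dG G' v) k = 0.
  rewrite -ddir_cross; apply: (mulIf (mulf_neq0 Hv Hv')); rewrite mul0r -mevalM.
  have G'v j : (cross G G' j).@[v] = 0.
    by rewrite cross_meval (eq_cross (frefl _) rE) crossZr crossvv mulr0.
  have := @vanish_ddir _ l charK (cross G G' k * (H * H')) v _ (proj2 cv).
  rewrite ddirM G'v mul0r addr0; apply=> w /nonzero2 w0 Fw; rewrite !mevalM.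
  have [->|Hw] := eqVneq H.@[w] 0; first by rewrite mul0r mulr0.
  have [->|Hw'] := eqVneq H'.@[w] 0; first by rewrite !mulr0.
  have [s _ sE] := prop w (conj w0 Fw) Hw Hw'.
  by rewrite cross_meval (eq_cross (frefl _) sE) crossZr crossvv mulr0 mul0r.
have [k nk] := smooth_cone (rep_on_cone rG cv Hv).
have := sc' k; rewrite (eq_cross rE (frefl _)) crossZl.
have -> : cross (G @@ v) (dG G' v) k = r * cross (G @@ v) (dG G v) k.
  apply/eqP; rewrite -subr_eq0 -mulNr addrC -[_ == _]/(_ == _); apply/eqP.
  rewrite -(dE k) (eq_cross (frefl (dG G v)) rE) crossZr [cross (dG G v) _ k]crossC.
  by rewrite mulrN mulNr.
rewrite sc (eq_cross (w' := fun i => r ^+ 2 * frob (G @@ v) i) rE) => [|i]; last first.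
  by rewrite /frob rE exprMn.
rewrite crossZl crossZr !mulrA => /(mulIf nk) e1 i; rewrite rE mulrA; congr (_ * _).
by apply: (mulfI (mulf_neq0 r0 r0)); rewrite e1; ring.
Qed.

(** If c = 0, then DG = k G at [v]. For M = G'(G), the chain rule and Euler's identity give DM = k
    d' M, a multiple of v as M = r v. Applying D to M x v = 0 then leaves r (v x Fr(v)) = 0, against
    smoothness. *)
Lemma slope_neq0 phi psi e d H G e' d' H' G' v c : cancel phi psi ->
  rep phi e d H G -> rep psi e' d' H' G' -> on_cone v -> H.@[v] != 0 ->
  H'.@[G @@ v] != 0 -> slope G v c -> c != 0.
Proof.
move=> phiK rG rG' cv Hv Hv' sc; apply/eqP => c0.
have [[i gi] Fg] := rep_on_cone rG cv Hv.
have [|k kE] := @cross_eq0 _ (G @@ v) (dG G v) (ex_intro _ i gi).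
  by move=> j; rewrite sc c0 mul0r.
pose M j := G' j \mPo [tuple G i | i < 3].
have ME w j : (M j).@[w] = (G' j).@[G @@ w] by rewrite meval_comp.
have prop w : on_cone w -> H.@[w] != 0 -> H'.@[G @@ w] != 0 ->
    exists2 r, r != 0 & forall i, (M i).@[w] = r * w i.
  move=> cw Hw Hw'; have [p pw] := cone_point cw.
  have := rep_line rG' (rep_line rG pw Hw) Hw'; rewrite phiK pw => rE.
  have [||r r0 rE'] := @vline_row_inj _ (fun i => (M i).@[w]) w; last by exists r.
    have [[j gj] _] := rep_on_cone rG' (rep_on_cone rG cw Hw) Hw'.
    by exists j; rewrite ME.
  by rewrite rE; congr <[_]>%VS; apply/rowP => j; rewrite !mxE ME.
have [r r0 rE] := prop v cv Hv Hv'.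
have dM j : ddir (M j) v (frob v) = k * (d'%:R * r) * v j.
  have [_ hG' _] := rG'.
  rewrite ddir_comp -!mulrA -rE ME -(ddir_euler _ (hG' j)) mulr_sumr.
  apply: eq_bigr => a _; rewrite tnth_mktuple -[ddir _ _ _]/(dG G v a) kE mulrCA.
  by congr (_ * (_ * _)); apply: meval_eq => b; rewrite tnth_mktuple.
have [j nj] := smooth_cone cv; case/negP: nj; apply/eqP.
have Mv b : (cross M (fun i => 'X_i) b).@[v] = 0.
  rewrite cross_meval (eq_cross rE (w' := v)) => [|a]; last exact: mevalXU.
  by rewrite crossZl crossvv mulr0.
have : ddir (cross M (fun i => 'X_i) j * (H * (H' \mPo [tuple G i | i < 3]))) v (frob v) = 0.
  apply: (vanish_ddir charK) (proj2 cv) => w /nonzero2 w0 Fw; rewrite !mevalM meval_comp.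
  have [->|Hw] := eqVneq H.@[w] 0; first by rewrite mul0r mulr0.
  have [->|Hw'] := eqVneq H'.@[G @@ w] 0; first by rewrite !mulr0.
  have [s _ sE] := prop w (conj w0 Fw) Hw Hw'.
  rewrite cross_meval (eq_cross sE (w' := w)) => [|a]; last exact: mevalXU.
  by rewrite crossZl crossvv mulr0 mul0r.
rewrite ddirM Mv mul0r addr0 => /eqP; rewrite mevalM meval_comp.
rewrite mulf_eq0 (negPf (mulf_neq0 Hv Hv')) orbF ddir_cross.
rewrite (eq_cross dM (w' := v)) => [|a]; last exact: mevalXU.
rewrite crossZl crossvv mulr0 add0r.
rewrite (eq_cross rE (w' := frob v)) => [|a]; last exact: ddirX.
by rewrite crossZl mulf_eq0 (negPf r0) => /eqP.
Qed.

End Rep.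

(** * The canonical lift to the cone *)

Section Cone.
Variables (K : closedFieldType) (l : K).
Hypothesis charK : 2%N \in [pchar K].
Hypothesis l_neq0 : l != 0.

Local Notation T := {mpoly K[3]}.
Local Notation F := (quartic l).
Local Notation C := (plane_curve F).
Local Notation G_at G v := (fun i => (G i).@[v]).

(** The factor ['X_i] keeps the degree at [d]; a bare derivative would have degree [d - 1], which is
    truncated for [d = 0]. *)
Lemma mderivX_homog d (A : T) i : A \is d.-homog -> A^`M(i) * 'X_i \is d.-homog.
Proof.
move=> /dhomogP hA; rewrite (mpolyE A) big_seq raddf_sum mulr_suml /=.
apply: rpred_sum => m /hA <-; rewrite mderivZ mderivX.
rewrite -!scalerAl -mpolyXD; apply: dhomogZ; case: (posnP (m i)) => [->|mi].
  by rewrite scale0r; exact: rpred0.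
by rewrite submK ?dhomogZ ?dhomogX // lep1mP -lt0n.
Qed.

Definition DG (G : 'I_3 -> T) i : T := \sum_j (G i)^`M(j) * 'X_j * 'X_j.

Lemma DG_meval (G : 'I_3 -> T) i v : (DG G i).@[v] = dG G v i.
Proof.
rewrite /DG /dG /ddir raddf_sum; apply: eq_bigr => j _ /=.
by rewrite !mevalM mevalXU -mulrA.
Qed.

Lemma DG_homog d (G : 'I_3 -> T) i : G i \is d.-homog -> DG G i \is d.+1.-homog.
Proof.
move=> hG; apply: rpred_sum => j _; rewrite -[d.+1]addn1; apply: dhomogM.
  exact: mderivX_homog.
by rewrite dhomogX /= mdeg1.
Qed.

Variables (phi psi : C -> C).
Hypotheses (r_phi : is_regular phi) (r_psi : is_regular psi) (phiK : cancel phi psi).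

Lemma rep_exists (f : C -> C) v : is_regular f -> on_cone l v ->
  exists e d H G, rep f e d H G /\ H.@[v] != 0.
Proof.
move=> rf /cone_point[p pv]; have [e [d [H [G [hH hG Hp fE]]]]] := rf p.
exists e, d, H, G; split=> //.
have [c _ hv] := point_coord pv; move: Hp.
by rewrite (meval_eq _ hv) (meval_homogZ _ _ hH) mulf_eq0 negb_or => /andP[].
Qed.

(* [w] is the canonical lift c G of phi at [v], for some local representation G. *)
Definition lift_at v (w : 'I_3 -> K) := exists e d H G c,
  [/\ rep phi e d H G, H.@[v] != 0, slope G v c & forall i, w i = c * (G i).@[v]].

Lemma lift_exists v : on_cone l v -> exists w, lift_at v w.
Proof.
move=> cv; have [e [d [H [G [rG Hv]]]]] := rep_exists r_phi cv.
have [c sc] := slopeP charK l_neq0 rG cv Hv.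
by exists (fun i => c * (G i).@[v]), e, d, H, G, c.
Qed.

Lemma lift_eq v w e d H G c : on_cone l v -> lift_at v w -> rep phi e d H G ->
  H.@[v] != 0 -> slope G v c -> forall i, w i = c * (G i).@[v].
Proof.
move=> cv [e' [d' [H' [G' [c' [rG' Hv' sc' wE]]]]]] rG Hv sc i.
by rewrite wE; apply: (slope_uniq charK l_neq0 rG rG' cv).
Qed.

Lemma lift_line v w (p : C) : lift_at v w -> line_of (val p) = <[\row_i v i]>%VS ->
  line_of (val (phi p)) = <[\row_i w i]>%VS.
Proof.
move=> [e [d [H [G [c [rG Hv sc wE]]]]]] pv.
have cv := point_on_cone pv.
have [e' [d' [H' [G' [rG' Hv']]]]] := rep_exists r_psi (rep_on_cone rG cv Hv).
have c0 := slope_neq0 charK l_neq0 phiK rG rG' cv Hv Hv' sc.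
rewrite (rep_line rG pv Hv) -(@vlineZ K c) //; congr <[_]>%VS.
by apply/rowP => i; rewrite !mxE wE.
Qed.

(** In v, G x DG has degree 2d + 1 and G x Fr(G) has degree 3d, so c has degree 1 - d and c G has
    degree 1. *)
Lemma lift_homog v w t : t != 0 -> on_cone l v -> lift_at v w ->
  lift_at (fun i => t * v i) (fun i => t * w i).
Proof.
move=> t0 cv [e [d [H [G [c [rG Hv sc wE]]]]]]; have [hH hG _] := rG.
have td0 : t ^+ d != 0 by rewrite expf_neq0.
have gE i : (G i).@[fun i => t * v i] = t ^+ d * (G i).@[v].
  by rewrite (meval_homogZ _ _ (hG i)).
exists e, d, H, G, (t * c / t ^+ d); split=> //.
- by rewrite (meval_homogZ _ _ hH) mulf_neq0 // expf_neq0.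
- have dE i : dG G (fun i => t * v i) i = t ^+ d.+1 * dG G v i.
    by rewrite -!DG_meval (meval_homogZ _ _ (DG_homog (hG i))).
  move=> k; rewrite (eq_cross gE dE) crossZl crossZr sc.
  rewrite (eq_cross gE (w' := fun i => (t ^+ d) ^+ 2 * frob (G_at G v) i)) => [|i].
    rewrite crossZl crossZr exprS !mulrA; congr (_ * _).
    rewrite -[t * c / t ^+ d * t ^+ d]mulrA mulVf // mulr1; ring.
  by rewrite /frob gE exprMn.
by move=> i; rewrite gE wE !mulrA divfK.
Qed.

(** The scalar c is the quotient of the k-th entries of G x DG and G x Fr(G), for an index k at
    which the latter is nonzero at [v]. The factor [H] makes both sides zero where [G] does not
    represent phi. *)
Lemma lift_regular v : on_cone l v -> exists (M : T) (N : 'I_3 -> T), M.@[v] != 0 /\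
  forall v' w i, on_cone l v' -> lift_at v' w -> w i * M.@[v'] = (N i).@[v'].
Proof.
move=> cv; have [e [d [H [G [rG Hv]]]]] := rep_exists r_phi cv.
have [k nk] := smooth_cone charK l_neq0 (rep_on_cone rG cv Hv).
pose M := H * cross G (fun i => G i ^+ 2) k.
have ME v' : M.@[v'] = H.@[v'] * cross (G_at G v') (frob (G_at G v')) k.
  rewrite mevalM cross_meval; congr (_ * _); apply: eq_cross => // i.
  by rewrite rmorphXn.
exists (M * M), (fun i => H * cross G (DG G) k * G i * M); split.
  by rewrite mevalM !ME !mulf_neq0.
move=> v' w i cv' lw; rewrite (mevalM _ M M) (mevalM _ _ M) mulrA; congr (_ * _).
have [Hv'|Hv'] := eqVneq H.@[v'] 0; first by rewrite ME !mevalM Hv' !mul0r mulr0.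
have [c sc] := slopeP charK l_neq0 rG cv' Hv'.
rewrite (lift_eq cv' lw rG Hv' sc) ME !mevalM cross_meval.
have -> : cross (G_at G v') (G_at (DG G) v') k = cross (G_at G v') (dG G v') k.
  by apply: eq_cross => // j; rewrite DG_meval.
by rewrite sc; ring.
Qed.

End Cone.

(** * Regular functions of degree one on the cone *)

(** The relation is the transition between two charts for the coefficient of x^i of a function of
    degree 1. It exchanges the exponents j and 1 - i - j of t, so neither can exceed 1 - i. *)
Lemma reversal_coef (K : closedFieldType) (a b : {poly K}) i :
  (forall t, t ^+ 2 + t != 0 -> a.[t] * t ^+ i = t * b.[t^-1]) ->
  forall j, a`_j = if (j + i <= 1)%N then b`_(1 - (j + i)) else 0.
Proof.
(* [r] is the reversal t^N b(1/t), which turns the relation into the polynomial identity a T^(i + N)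
   = T r. *)
move=> ab j; pose N := size b; pose r := \poly_(k < N.+1) b`_(N - k).
have rE t : t != 0 -> r.[t] = t ^+ N * b.[t^-1].
  move=> t0; rewrite (horner_coef_wide _ (leqnSn N)) mulr_sumr /r horner_poly.
  rewrite (reindex_inj rev_ord_inj) /=; apply: eq_bigr => k _.
  have kN : (k <= N)%N by rewrite -ltnS.
  rewrite subSS subKn // exprVn mulrCA; congr (_ * _).
  have e n m : (m <= n)%N -> t ^+ (n - m) = t ^+ n / t ^+ m.
    by move=> mn; rewrite -{2}(subnK mn) exprD mulfK // expf_neq0.
  exact: e.
have : a * 'X^(i + N) = 'X * r.
  apply/eqP; rewrite -subr_eq0; apply/eqP; apply: (@poly_eq0_generic _ ('X^2 + 'X)) => [|t].
    by rewrite -size_poly_eq0 size_polyDl size_polyXn // size_polyX.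
  rewrite !(hornerD, hornerN, hornerM, hornerXn, hornerX) => t0.
  have tn0 : t != 0 by apply: contraNneq t0 => ->; rewrite expr0n addr0.
  by rewrite rE // exprD mulrA ab // mulrAC [in X in _ - X]mulrA subrr.
move/polyP/(_ (j + (i + N))%N); rewrite coefMXn ltnNge leq_addl /= addnK => ->.
rewrite coefXM addnA; case: (posnP (j + i + N)) => [|].
  move=> e; have b0 : b = 0.
    by apply/eqP; rewrite -size_poly_eq0; move/eqP: e; rewrite addn_eq0 => /andP[].
  by rewrite b0 !coef0 if_same.
move=> jN; rewrite coef_poly -ltnS prednK // addnC.
case: (j + i)%N jN => [|[|k]] /=; rewrite ?addn0 => jN.
- by rewrite ltnW //= -subn1 subnBA // addnC addnK.
- by rewrite addn1 /= !ltnSn subnn.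
by rewrite !addnS !ltnS ltnNge leq_addr.
Qed.

Section Linear.
Variables (K : closedFieldType) (l : K).
Hypothesis charK : 2%N \in [pchar K].

Local Notation T := {mpoly K[3]}.

Lemma chart_mpoly (a b : {poly K}) (A : T) : exists Q : {poly {poly K}},
  forall x t, Q.[x%:P].[t] = A.@[vec3 x a.[t] b.[t]].
Proof.
elim/mpoly_ring_ind: A => [c|i|A B [P PA] [Q QB]|A B [P PA] [Q QB]].
- by exists c%:P%:P => x t; rewrite !hornerC mevalC.
- elim/ord3P: i; [exists 'X | exists a%:P | exists b%:P] => x t;
    by rewrite mevalXU /vec3 /= ?hornerX ?hornerC.
- by exists (P + Q) => x t; rewrite !hornerD PA QB mevalD.
by exists (P * Q) => x t; rewrite !hornerM PA QB mevalM.
Qed.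

Lemma horner2_coef n (A : {poly {poly K}}) x t : (size A <= n)%N ->
  A.[x%:P].[t] = \sum_(i < n) (A`_i).[t] * x ^+ i.
Proof.
move=> sA; rewrite (horner_coef_wide _ sA) -[LHS]/(horner_eval t _) rmorph_sum.
apply: eq_bigr => i _; rewrite rmorphM rmorphXn /= /horner_eval.
by rewrite hornerC.
Qed.

Variable f : ('I_3 -> K) -> K.
Hypothesis fZ : forall t v, t != 0 -> on_cone l v -> f (fun i => t * v i) = t * f v.
Hypothesis f_loc : forall v, on_cone l v -> exists M N : T, M.@[v] != 0 /\
  forall v', on_cone l v' -> f v' * M.@[v'] = N.@[v'].

Lemma chart_fun (a b : {poly K}) :
  (forall x t, nonzero (vec3 x a.[t] b.[t])) ->
  exists2 A : {poly {poly K}}, (size A <= 4)%N &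
    forall x t, qform l x a.[t] b.[t] = 0 -> f (vec3 x a.[t] b.[t]) = A.[x%:P].[t].
Proof.
move=> nz; apply: (chart_regular (f := fun x t => f (vec3 x a.[t] b.[t]))).
have cE x t : qform l x a.[t] b.[t] = 0 -> on_cone l (vec3 x a.[t] b.[t]).
  by move=> xt; split; [exact: nz | rewrite quarticE].
move=> x t /cE/f_loc[M [N [M0 fM]]].
have [P PE] := chart_mpoly a b M; have [Q QE] := chart_mpoly a b N.
exists P, Q; rewrite PE; split=> // x' t' /cE xt'.
by rewrite PE QE fM.
Qed.

(** On the charts Z = 1 and Y = 1, [f] is given by polynomials [A] and [B] of degree at most 3 in x.
    On the overlap, (x, t, 1) = t (x/t, 1, 1/t), so homogeneity relates their coefficients by A_i(t)
    t^i = t B_i(1/t). By [reversal_coef], the total degree is then at most 1. *)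
Lemma cone_linear : exists c : 'I_3 -> K, forall v, on_cone l v -> f v = \sum_i c i * v i.
Proof.
have [|A sA fA] := @chart_fun 'X 1.
  by move=> x t; exists 2; rewrite /vec3 /= hornerC oner_neq0.
have [|B sB fB] := @chart_fun 1 'X.
  by move=> x t; exists 1; rewrite /vec3 /= hornerC oner_neq0.
have AB i t : t ^+ 2 + t != 0 -> (A`_i).[t] * t ^+ i = t * (B`_i).[t^-1].
  move=> tt; have t0 : t != 0 by apply: contraNneq tt => ->; rewrite expr0n addr0.
  have [i4|i4] := ltnP i 4; last first.
    by rewrite !nth_default ?(leq_trans _ i4) // !hornerC mul0r mulr0.
  (* For fixed t, the two descriptions differ by a polynomial in x of degree at most 3 that vanishes
     at four points, so they agree coefficient by coefficient. *)
  pose p := \poly_(i < 4) ((A`_i).[t] - t * (B`_i).[t^-1] * t ^- i).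
  have p0 : p = 0.
    apply: (qform_poly_van (l := l) (y := t) (z := 1) charK); rewrite ?size_poly //.
      by rewrite mul1r mulr1.
    move=> x xt; rewrite horner_poly; under eq_bigr => k _ do rewrite mulrBl.
    rewrite sumrB -horner2_coef //.
    have := fA x t; rewrite hornerX hornerC => <- //.
    have xt' : qform l (x / t) 1 t^-1 = 0.
      have := qform_homog l t^-1 x t 1; rewrite xt mulr0 mulVf // mulr1 mulrC => <-.
      by rewrite mulrC.
    have := fB (x / t) t^-1; rewrite hornerX hornerC => /(_ xt') fBt.
    have -> : vec3 x t 1 = (fun i => t * vec3 (x / t) 1 t^-1 i).
      by apply/funext; elim/ord3P; rewrite /vec3 /= ?mulr1 ?divff // mulrC divfK.
    rewrite fZ //; last first.
      by split; [exists 1; rewrite /vec3 /= oner_neq0 | rewrite quarticE].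
    rewrite fBt (@horner2_coef 4) // mulr_sumr -sumrB big1 // => k _.
    by rewrite exprMn exprVn !mulrA mulrAC subrr.
  move/polyP/(_ i): p0; rewrite coef_poly i4 coef0 => /eqP; rewrite subr_eq0 => /eqP ->.
  by rewrite divfK // expf_neq0.
have BA i s : s ^+ 2 + s != 0 -> (B`_i).[s] * s ^+ i = s * (A`_i).[s^-1].
  move=> ss; have s0 : s != 0 by apply: contraNneq ss => ->; rewrite expr0n addr0.
  have ss' : s^-1 ^+ 2 + s^-1 != 0.
    have -> : s^-1 ^+ 2 + s^-1 = (s ^+ 2 + s) / (s ^+ 3) by field.
    by rewrite mulf_neq0 // invr_neq0 // expf_neq0.
  have := AB i s^-1 ss'; rewrite invrK => /(canLR (mulKf (invr_neq0 s0))) <-.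
  by rewrite invrK exprVn -!mulrA mulVf ?mulr1 // expf_neq0.
have cA i := reversal_coef (AB i); have cB i := reversal_coef (BA i).
have sizeC (a b : {poly K}) i :
    (forall j, a`_j = if (j + i <= 1)%N then b`_(1 - (j + i)) else 0) ->
    (size a <= 2 - i)%N.
  move=> ab; apply/leq_sizeP => j; rewrite leq_subLR addnC ab.
  by case: leqP => // ji /leq_trans/(_ ji).
have expand (P Q : {poly {poly K}}) : (size P <= 4)%N ->
    (forall i j, P`_i`_j = if (j + i <= 1)%N then Q`_i`_(1 - (j + i)) else 0) ->
    forall x t, P.[x%:P].[t] = P`_0`_0 + P`_0`_1 * t + P`_1`_0 * x.
  move=> sP PQ x t; rewrite (horner2_coef _ _ sP) !big_ord_recl big_ord0 /=.
  rewrite (horner_coef_wide _ (sizeC _ _ _ (PQ 0%N))).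
  rewrite (horner_coef_wide _ (sizeC _ _ _ (PQ 1%N))).
  rewrite (horner_coef_wide _ (sizeC _ _ _ (PQ 2%N))).
  rewrite (horner_coef_wide _ (sizeC _ _ _ (PQ 3%N))).
  by rewrite !big_ord_recl !big_ord0 /= /bump /=; ring.
(* The coefficients are read off from [A]. For points with Z = 0 the chart Y = 1 is used, and [cB]
   matches the coefficients of [B] with these. *)
exists (vec3 A`_1`_0 A`_0`_1 A`_0`_0) => v cv; have [v0 Fv] := cv.
have [z0|z0] := eqVneq (v 2) 0; last first.
  have vE : v = fun i => v 2 * vec3 (v 0 / v 2) (v 1 / v 2) 1 i.
    by apply/funext; elim/ord3P; rewrite /vec3 /= ?mulr1 // mulrC divfK.
  have cv' : on_cone l (vec3 (v 0 / v 2) (v 1 / v 2) 1).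
    suff -> : vec3 (v 0 / v 2) (v 1 / v 2) 1 = fun i => (v 2)^-1 * v i.
      exact: on_coneZ (invr_neq0 z0) cv.
    by apply/funext; elim/ord3P; rewrite /vec3 /= ?mulVf // mulrC.
  rewrite {1}vE fZ // sum3 /vec3 /=.
  have := fA (v 0 / v 2) (v 1 / v 2); rewrite hornerX hornerC => ->; last first.
    by have [_] := cv'; rewrite quarticE.
  by rewrite (expand _ _ sA cA); field.
have [y0|y0] := eqVneq (v 1) 0.
  (* The point (1 : 0 : 0) is not on the curve. *)
  case: v0 => i; have x0 : v 0 = 0; last by elim/ord3P: i; rewrite ?x0 ?y0 ?z0 eqxx.
  move: Fv; rewrite quarticE y0 z0; have -> : qform l (v 0) 0 0 = v 0 ^+ 4.
    by rewrite /qform; ring.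
  by move/eqP; rewrite expf_eq0 => /eqP.
have vE : v = fun i => v 1 * vec3 (v 0 / v 1) 1 0 i.
  by apply/funext; elim/ord3P; rewrite /vec3 /= ?mulr1 ?mulr0 ?z0 // mulrC divfK.
have cv' : on_cone l (vec3 (v 0 / v 1) 1 0).
  suff -> : vec3 (v 0 / v 1) 1 0 = fun i => (v 1)^-1 * v i.
    exact: on_coneZ (invr_neq0 y0) cv.
  by apply/funext; elim/ord3P; rewrite /vec3 /= ?mulVf ?z0 ?mulr0 // mulrC.
rewrite {1}vE fZ // sum3 /vec3 /= z0.
have := fB (v 0 / v 1) 0; rewrite hornerX hornerC => ->; last first.
  by have [_] := cv'; rewrite quarticE.
by rewrite (expand _ _ sB cB) (cB 0%N 0%N) (cB 1%N 0%N) /=; field.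
Qed.

End Linear.

(** * Linearity and rationality over F_2 *)

Section LinearMaps.
Variable K : fieldType.
Implicit Types (L : 'I_3 -> 'I_3 -> K) (v : 'I_3 -> K).

Definition lin L v : 'I_3 -> K := fun i => \sum_j L i j * v j.

Lemma lin3 L v i : lin L v i = L i 0 * v 0 + L i 1 * v 1 + L i 2 * v 2.
Proof. exact: sum3. Qed.

Definition linG L : 'I_3 -> {mpoly K[3]} := fun i => \sum_j L i j *: 'X_j.

Lemma meval_linG L v i : (linG L i).@[v] = lin L v i.
Proof.
by rewrite /linG raddf_sum; apply: eq_bigr => j _; rewrite /= mevalZ mevalXU.
Qed.

Lemma linG_homog L i : linG L i \is 1.-homog.
Proof. by apply: rpred_sum => j _; rewrite dhomogZ // dhomogX /= mdeg1. Qed.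

Lemma ddir_linG L v w i : ddir (linG L i) v w = lin L w i.
Proof.
rewrite /linG /lin; elim/big_rec2: _ => [|j a A _ <-].
  by rewrite -mpolyC0 ddirC.
by rewrite ddirD -mul_mpolyC ddirM ddirC mul0r add0r mevalC ddirX.
Qed.

End LinearMaps.

Section Automorphism.
Variables (K : closedFieldType) (l : K).
Hypothesis charK : 2%N \in [pchar K].
Hypothesis l_neq0 : l != 0.

Local Notation T := {mpoly K[3]}.
Local Notation F := (quartic l).
Local Notation C := (plane_curve F).

Lemma omega_exists : exists w : K, w ^+ 2 + w = 1.
Proof.
have [|w] := closed_rootP ('X^2 + 'X - 1 : {poly K}) _.
  rewrite -addrA size_polyDl size_polyXn //.
  by apply: leq_ltn_trans (size_polyD _ _) _; rewrite size_polyN size_polyX size_poly1.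
rewrite rootE !(hornerD, hornerN, hornerXn, hornerX, hornerC) => /eqP w0.
by exists w; apply/eqP; rewrite -subr_eq0; apply/eqP.
Qed.

(** On Z = 0 the form is (X^2 + XY + Y^2)^2; these are the two points of the curve at infinity. *)
Lemma omega_cone (w : K) : w ^+ 2 + w = 1 ->
  on_cone l (vec3 1 w 0) /\ on_cone l (vec3 w 1 0).
Proof.
move=> w2; have t0 := two_eq0 charK; have t11 : 1 + 1 = 0 :> K := t0.
split; split; first by exists 0; exact: oner_neq0.
- rewrite quarticE /vec3 /=.
  have -> : qform l 1 w 0 = (w ^+ 2 + w + 1) ^+ 2.
    by apply: (eq2 charK); rewrite /qform; ring2 t0.
  by rewrite w2 t11 expr0n.
- by exists 1; exact: oner_neq0.
rewrite quarticE /vec3 /=.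
have -> : qform l w 1 0 = (w ^+ 2 + w + 1) ^+ 2.
  by apply: (eq2 charK); rewrite /qform; ring2 t0.
by rewrite w2 t11 expr0n.
Qed.

Section Linearity.
Variables (phi psi : C -> C).
Hypotheses (r_phi : is_regular phi) (r_psi : is_regular psi) (phiK : cancel phi psi).

Lemma regular_linear : exists L : 'I_3 -> 'I_3 -> K,
  forall v, on_cone l v -> lift_at phi v (lin L v).
Proof.
have /choice[Lam LamP] : forall v, exists w, on_cone l v -> lift_at phi v w.
  move=> v; have [cv|ncv] := pselect (on_cone l v); last by exists v.
  by have [w vw] := lift_exists charK l_neq0 r_phi cv; exists w.
have LamZ t v : t != 0 -> on_cone l v -> Lam (fun i => t * v i) =1 (fun i => t * Lam v i).
  move=> t0 cv i; have ctv := on_coneZ t0 cv.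
  have [e [d [H [G [c [rG Hv sc wE]]]]]] := lift_homog t0 cv (LamP v cv).
  by rewrite (lift_eq charK l_neq0 ctv (LamP _ ctv) rG Hv sc) -wE.
have /choice[L LE] : forall i, exists c : 'I_3 -> K,
    forall v, on_cone l v -> Lam v i = \sum_j c j * v j.
  move=> i; apply: (cone_linear charK (f := fun v => Lam v i)) => [t v t0 cv|v cv].
    exact: LamZ.
  have [M [N [Mv MN]]] := lift_regular charK l_neq0 r_phi cv.
  by exists M, (N i); split=> // v' cv'; apply: MN => //; exact: LamP.
exists L => v cv; suff -> : lin L v = Lam v by exact: LamP.
by apply/funext => i; rewrite LE.
Qed.

Lemma linear_rep L : (forall v, on_cone l v -> lift_at phi v (lin L v)) ->
  rep phi 0 1 1 (linG L).
Proof.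
move=> lL; split; [exact: dhomog1 | exact: linG_homog |] => q _.
have cq := on_cone_hcoord q.
rewrite (lift_line charK l_neq0 r_psi phiK (lL _ cq)).
  by congr <[_]>%VS; apply/rowP => i; rewrite !mxE meval_linG.
rewrite line_ofE; congr <[_]>%VS; apply/rowP => i; by rewrite mxE.
Qed.

(** The matrix itself represents phi on the whole curve, with D(L v) = L Fr(v). As its canonical
    lift c L v is again L v, the slope c is 1. *)
Lemma linear_slope L v : (forall v, on_cone l v -> lift_at phi v (lin L v)) ->
  on_cone l v -> forall k, cross (lin L v) (lin L (frob v)) k
    = cross (lin L v) (frob (lin L v)) k.
Proof.
move=> lL cv k; have rL := linear_rep lL.
have H1 : (1 : T).@[v] != 0 by rewrite meval1 oner_neq0.
have [c sc] := slopeP charK l_neq0 rL cv H1.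
have [[i gi] _] := rep_on_cone rL cv H1; rewrite meval_linG in gi.
have := lift_eq charK l_neq0 cv (lL v cv) rL H1 sc i.
rewrite meval_linG -[LHS]mul1r => /(mulIf gi) c1.
have := sc k; rewrite -c1 mul1r.
have gE : (fun i => (linG L i).@[v]) =1 lin L v by move=> j; rewrite meval_linG.
have dE : dG (linG L) v =1 lin L (frob v) by move=> j; rewrite /dG ddir_linG.
rewrite (eq_cross gE dE) => ->; apply: eq_cross => // j.
by rewrite /frob gE.
Qed.

End Linearity.

Lemma chart1_van (P : {poly {poly K}}) : (size P <= 4)%N ->
  (forall x t, qform l x t 1 = 0 -> P.[x%:P].[t] = 0) -> P = 0.
Proof.
move=> sP vP; apply: (chart_van (l := l) (a := 'X) (b := 1) charK) => //.
  by rewrite mul1r mulr1 -size_poly_eq0 size_polyDl size_polyXn // size_polyX.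
by move=> x t; rewrite hornerX hornerC; exact: vP.
Qed.

(** The nine monomials v_i v_j^2 are distinct, so the [w i j] are the coefficients of a cubic form.
    At Z = 1 it has degree at most 3 in x, hence vanishes identically by [chart1_van]. *)
Lemma cubic_vanish (w : 'I_3 -> 'I_3 -> K) :
  (forall v, on_cone l v -> \sum_i \sum_j v i * v j ^+ 2 * w i j = 0) ->
  forall i j, w i j = 0.
Proof.
move=> w0.
(* [c0] to [c3] collect the coefficients of x^0 to x^3 at z = 1, as polynomials in y. *)
pose c0 := Poly [:: w 2 2; w 1 2; w 2 1; w 1 1].
pose c1 := Poly [:: w 0 2; 0; w 0 1].
pose c2 := Poly [:: w 2 0; w 1 0].
pose c3 := Poly [:: w 0 0].
have : Poly [:: c0; c1; c2; c3] = 0.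
  apply: chart1_van => [|x t xt]; first exact: size_Poly.
  have := w0 (vec3 x t 1); rewrite !sum3 /vec3 /= => <-; last first.
    by split; [exists 2; exact: oner_neq0 | rewrite quarticE].
  rewrite /c0 /c1 /c2 /c3 /= !(horner_cons, hornerD, hornerM, hornerC).
  by ring.
move/polyP => P0.
have e0 := P0 0%N; have e1 := P0 1%N; have e2 := P0 2%N; have e3 := P0 3%N.
rewrite !coef_Poly !coef0 /= in e0 e1 e2 e3.
have d i := conj (congr1 (fun p : {poly K} => p`_i) e0)
  (conj (congr1 (fun p : {poly K} => p`_i) e1)
  (conj (congr1 (fun p : {poly K} => p`_i) e2) (congr1 (fun p : {poly K} => p`_i) e3))).
have [d00 [d10 [d20 d30]]] := d 0%N; have [d01 [d11 [d21 d31]]] := d 1%N.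
have [d02 [d12 _]] := d 2%N; have [d03 _] := d 3%N.
rewrite !coef_Poly !coef0 /= in d00 d10 d20 d30 d01 d11 d21 d31 d02 d12 d03.
by elim/ord3P; elim/ord3P.
Qed.

Lemma frob_lin (L : 'I_3 -> 'I_3 -> K) v i :
  frob (lin L v) i = lin (fun i j => L i j ^+ 2) (frob v) i.
Proof.
have t0 := two_eq0 charK.
by rewrite /frob /lin !sum3; apply: (eq2 charK); ring2 t0.
Qed.

Section Rationality.
Variables (phi psi : C -> C).
Hypotheses (r_phi : is_regular phi) (r_psi : is_regular psi) (phiK : cancel phi psi).

Lemma not_constant (u : 'I_3 -> K) :
  ~ (forall p, line_of (val (phi p)) = <[\row_i u i]>%VS).
Proof.
move=> phiu; have [w w2] := omega_exists; have [c1 c2] := omega_cone w2.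
have [p pE] := cone_point c1; have [q qE] := cone_point c2.
have pq : p = q.
  apply: (can_inj phiK); do 2!apply: val_inj.
  exact: etrans (phiu p) (esym (phiu q)).
have [||c c0 cE] := @vline_row_inj _ (vec3 1 w 0) (vec3 w 1 0).
- by case: c1.
- by rewrite -pE -qE pq.
have := cE 0; have := cE 1; rewrite /vec3 /= mulr1 => <- w1.
have := w2; rewrite expr2 -w1 => /eqP; rewrite -subr_eq0 addrC addKr.
by move=> /eqP w0; move/eqP: w1; rewrite w0 mulr0 oner_eq0.
Qed.

(** In the cubic form L v x (Fr(L v) - L Fr(v)), the coefficient of v_a v_b^2 is, up to sign, column
    a of L times column b of the matrix of the L_ij^2 - L_ij, as a cross product. If a column of the
    latter were nonzero, all columns of L would be multiples of it, and phi would be constant. *)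
Lemma linear_idempotent L : (forall v, on_cone l v -> lift_at phi v (lin L v)) ->
  forall i j, L i j ^+ 2 = L i j.
Proof.
move=> lL; pose E j i := L i j ^+ 2 - L i j.
have W0 k : forall a b, cross (L^~ a) (E b) k = 0.
  apply: cubic_vanish => v cv.
  transitivity (cross (lin L v) (fun i => frob (lin L v) i - lin L (frob v) i) k).
    rewrite (eq_cross (frefl _) (w' := lin (fun i j => E j i) (frob v))) => [|i]; last first.
      by rewrite frob_lin /lin -sumrB; apply: eq_bigr => j _; rewrite mulrBl.
    by rewrite !sum3 /lin /frob; elim/ord3P: k; rewrite /cross /vec3 /= !sum3; ring.
  have sl := linear_slope r_psi phiK lL cv.
  have -> : cross (lin L v) (fun i => frob (lin L v) i - lin L (frob v) i) k
      = cross (lin L v) (frob (lin L v)) k - cross (lin L v) (lin L (frob v)) k.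
    by elim/ord3P: k; rewrite /cross /vec3 /=; ring.
  by rewrite sl subrr.
move=> i j; apply/eqP; rewrite -subr_eq0; apply/negPn/negP => Eij.
have prop a : exists c, forall k, L k a = c * E j k.
  apply: cross_eq0; first by exists i.
  by move=> k; rewrite crossC W0 oppr0.
have /choice[c cE] := prop.
case: (not_constant (u := E j)) => p.
have cp := on_cone_hcoord p.
have pE : line_of (val p) = <[\row_i hcoord (val p) i]>%VS.
  by rewrite line_ofE; congr <[_]>%VS; apply/rowP => k; rewrite mxE.
have := lift_line charK l_neq0 r_psi phiK (lL _ cp) pE.
set s := \sum_a c a * hcoord (val p) a.
have -> : \row_k lin L (hcoord (val p)) k = s *: \row_k E j k.
  apply/rowP => k; rewrite !mxE /lin /s mulr_suml; apply: eq_bigr => a _.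
  by rewrite cE mulrAC.
have [->|s0] := eqVneq s 0; last by rewrite vlineZ.
rewrite scale0r line_ofE => /eqP.
by rewrite -dimv_eq0 dim_vline hcoord_neq0.
Qed.

End Rationality.

End Automorphism.

(** * Permutation of the four affine points over F_2 *)

Lemma qform_line (R : comNzRingType) (l a0 a1 a2 b0 b1 b2 : R) : exists c1 c2 c3 : R,
  forall x, qform l (a0 * x + b0) (a1 * x + b1) (a2 * x + b2)
  = qform l a0 a1 a2 * x ^+ 4 + (c3 * x ^+ 3 + (c2 * x ^+ 2 + (c1 * x + qform l b0 b1 b2))).
Proof.
(* The [u] and [v] are the coefficients of X^2 + XZ and Y^2 + YZ restricted to the line. *)
pose u2 := a0 ^+ 2 + a0 * a2; pose v2 := a1 ^+ 2 + a1 * a2.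
pose u1 := 2 * a0 * b0 + a0 * b2 + a2 * b0; pose v1 := 2 * a1 * b1 + a1 * b2 + a2 * b1.
pose u0 := b0 ^+ 2 + b0 * b2; pose v0 := b1 ^+ 2 + b1 * b2.
exists (2 * u1 * u0 + u1 * v0 + u0 * v1 + 2 * v1 * v0 + 4 * l * a2 * b2 ^+ 3).
exists (2 * u2 * u0 + u1 ^+ 2 + u2 * v0 + u1 * v1 + u0 * v2 + 2 * v2 * v0 + v1 ^+ 2
  + 6 * l * a2 ^+ 2 * b2 ^+ 2).
exists (2 * u2 * u1 + u2 * v1 + u1 * v2 + 2 * v2 * v1 + 4 * l * a2 ^+ 3 * b2).
by move=> x; rewrite /qform /u0 /u1 /u2 /v0 /v1 /v2; ring.
Qed.

Section LinearGroup.
Variables (K : closedFieldType) (l : K).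
Hypothesis charK : 2%N \in [pchar K].
Hypothesis l_neq0 : l != 0.
Hypothesis l_neq1 : l != 1.

Definition qf (v : 'I_3 -> K) := qform l (v 0) (v 1) (v 2).

(** Both sides are quartic in x with the same leading coefficient, and for general y their
    difference vanishes at four values of x. The remaining y follow, as the difference is also a
    polynomial in y. *)
Lemma qf_lin L : (forall v, on_cone l v -> qf (lin L v) = 0) ->
  forall x y, qf (lin L (vec3 x y 1)) = qf (L^~ 0) * qform l x y 1.
Proof.
move=> L0 x y; set m := qf (L^~ 0).
have generic t z : t ^+ 2 + t != 0 -> qf (lin L (vec3 z t 1)) = m * qform l z t 1.
  move=> tt.
  have [c1 [c2 [c3 cE]]] := qform_line l (L 0 0) (L 1 0) (L 2 0)
    (L 0 1 * t + L 0 2) (L 1 1 * t + L 1 2) (L 2 1 * t + L 2 2).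
  have [d1 [d2 [d3 dE]]] := qform_line l 1 0 0 0 t 1.
  have linE s : qf (lin L (vec3 s t 1)) = m * s ^+ 4
      + (c3 * s ^+ 3 + (c2 * s ^+ 2 + (c1 * s + qform l (L 0 1 * t + L 0 2)
        (L 1 1 * t + L 1 2) (L 2 1 * t + L 2 2)))).
    by rewrite -cE /qf /lin !sum3 /vec3 /= !mulr1 !addrA.
  have oneE s : qform l s t 1 = s ^+ 4
      + (d3 * s ^+ 3 + (d2 * s ^+ 2 + (d1 * s + qform l 0 t 1))).
    have q1 : qform l 1 0 0 = 1 by rewrite /qform; ring.
    by have := dE s; rewrite q1 !mul0r !add0r !mul1r addr0.
  pose p := \poly_(i < 4) nth 0 [:: qform l (L 0 1 * t + L 0 2)
        (L 1 1 * t + L 1 2) (L 2 1 * t + L 2 2) - m * qform l 0 t 1;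
      c1 - m * d1; c2 - m * d2; c3 - m * d3] i.
  have pE s : p.[s] = qf (lin L (vec3 s t 1)) - m * qform l s t 1.
    rewrite linE oneE horner_poly !big_ord_recl big_ord0 /= /bump /=; ring.
  have p0 : p = 0.
    apply: (qform_poly_van (l := l) (y := t) (z := 1) charK); rewrite ?size_poly //.
      by rewrite mul1r mulr1.
    move=> s st; rewrite pE st mulr0 subr0; apply: L0.
    by split; [exists 2; exact: oner_neq0 | rewrite quarticE].
  by apply/eqP; rewrite -subr_eq0 -pE p0 horner0.
pose q := qform l%:P ((L 0 0 * x)%:P + (L 0 1 *: 'X + (L 0 2)%:P))
    ((L 1 0 * x)%:P + (L 1 1 *: 'X + (L 1 2)%:P)) ((L 2 0 * x)%:P + (L 2 1 *: 'X + (L 2 2)%:P))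
  - m%:P * qform l%:P x%:P 'X 1%:P.
have qE t : q.[t] = qf (lin L (vec3 x t 1)) - m * qform l x t 1.
  rewrite /q hornerD hornerN hornerM hornerC !horner_qform.
  rewrite !(hornerD, hornerZ, hornerX, hornerC) /qf /lin !sum3 /vec3 /=.
  by rewrite !mulr1 !addrA.
have q0 : q = 0.
  apply: (@poly_eq0_generic _ ('X^2 + 'X)) => [|t].
    by rewrite -size_poly_eq0 size_polyDl size_polyXn // size_polyX.
  by rewrite qE !(hornerD, hornerXn, hornerX) => /generic ->; rewrite subrr.
by apply/eqP; rewrite -subr_eq0 -qE q0 horner0.
Qed.

Definition aff_pt (k : 'I_4) : 'I_3 -> K := vec3 (odd k)%:R (1 < k)%N%:R 1.

Let c2 : 2 = 0 :> K := two_eq0 charK.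

Lemma addb_natr (a b : bool) : (a (+) b)%:R = a%:R + b%:R :> K.
Proof. by case: a b => [] [] /=; rewrite ?addr0 ?add0r // -[RHS]/(2 : K) c2. Qed.

Lemma idem01 (a : K) : a ^+ 2 = a -> exists b : bool, a = b%:R.
Proof.
move/eqP; rewrite -subr_eq0 expr2 -{3}[a]mulr1 -mulrBr mulf_eq0 subr_eq0.
by case/orP=> /eqP->; [exists false | exists true].
Qed.

Lemma qform_bits (a b c : bool) : qform l a%:R b%:R c%:R = if c then l else (a || b)%:R.
Proof.
rewrite /qform; apply: (eq2 charK).
by case: a b c => [] [] [] /=; ring2 c2.
Qed.

Lemma ptP (a b : bool) : exists k, aff_pt k =1 vec3 a%:R b%:R 1.
Proof.
case: a b => [] []; [exists (inord 3)|exists (inord 1)|exists (inord 2)|exists (inord 0)];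
  by rewrite /aff_pt inordK.
Qed.

Lemma affine_perm L : (forall v, on_cone l v -> on_cone l (lin L v)) ->
  (forall i j, L i j ^+ 2 = L i j) ->
  exists s : 'S_4, forall k, lin L (aff_pt k) =1 aff_pt (s k).
Proof.
move=> Lcone Lidem.
have L0 v : on_cone l v -> qf (lin L v) = 0 by move=> /Lcone[_]; rewrite quarticE.
have /choice[B BE] : forall i, exists b : 'I_3 -> bool, forall j, L i j = (b j)%:R.
  move=> i; have /choice[b bE] : forall j, exists c : bool, L i j = c%:R.
    by move=> j; apply: idem01.
  by exists b.
have linB (a b c : bool) i : lin L (vec3 a%:R b%:R c%:R) i
    = ((B i 0 && a) (+) (B i 1 && b) (+) (B i 2 && c))%:R.
  by rewrite /lin sum3 !BE /vec3 /= !addb_natr -!mulnb !natrM.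
have Q := qf_lin L0; set m := qf (L^~ 0) in Q.
have QB (a b : bool) : qf (lin L (vec3 a%:R b%:R 1)) = m * l.
  by rewrite Q; have := qform_bits a b true; rewrite /= => ->.
have mE : m = if B 2 0 then l else (B 0 0 || B 1 0)%:R.
  by rewrite /m /qf !BE qform_bits.
have [w w2] := omega_exists K.
(* [m * l] is a value of the form at a vector over F_2, and such values are l, 1 or 0. *)
have m_val : m * l = 0 \/ m * l = 1 \/ m * l = l.
  rewrite -(QB true true) /qf !(linB true true true) qform_bits.
  by case: (_ (+) _); [right; right | case: (_ || _); [right; left | left]].
have m1 : m = 1.
  (* If [B 2 0] holds, then m = l, and l^2 would be 0, 1 or l. *)
  case B20: (B 2 0) mE => mE.
    have ml := mE; have [e|[e|e]] := m_val; rewrite ml in e.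
    - by move/eqP: e; rewrite mulf_eq0 orbb (negPf l_neq0).
    - have /eqP : (l + 1) ^+ 2 = 0.
        by transitivity (l * l + 1); [apply: (eq2 charK); ring2 c2 | rewrite e; exact: c2].
      by rewrite expf_eq0 /= addr_eq0 (opp2 charK) (negPf l_neq1).
    by move/eqP: e; rewrite -{3}[l]mul1r -subr_eq0 -mulrBl mulf_eq0 subr_eq0
      (negPf l_neq1) (negPf l_neq0).
  (* If m = 0, the form vanishes at the images of the affine points. Over F_2 it vanishes only at
     the zero vector, so these images are zero. As column 0 is zero too, L = 0, which maps no point
     to the curve. *)
  case B00: (B 0 0) mE => //=; case B10: (B 1 0) => //= m0.
  have zero (a b c : bool) : qform l a%:R b%:R c%:R = 0 ->
      [/\ a = false, b = false & c = false].
    rewrite qform_bits; case: c => [|/eqP]; first by move/eqP; rewrite (negPf l_neq0).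
    by case: a b => [] [] //=; rewrite oner_eq0.
  have col a b := QB a b; rewrite m0 mul0r /qf in col.
  have := col false false; rewrite (linB false false true) (linB false false true)
    (linB false false true) => /zero; rewrite !andbF !andbT /= => -[B02 B12 B22].
  have := col false true; rewrite (linB false true true) (linB false true true)
    (linB false true true) => /zero.
  rewrite B02 B12 B22 !andbF !andbT !addbF /= => -[B01 B11 B21].
  have [/Lcone[[i]]] := omega_cone l charK w2.
  rewrite /lin sum3 !BE; elim/ord3P: i;
    by rewrite ?B00 ?B10 ?B20 ?B01 ?B11 ?B21 ?B02 ?B12 ?B22 /= ?mulr0n !mul0r !addr0 eqxx.
(* Since l is neither 0 nor 1, a vector over F_2 with value l must have Z = 1. *)
have z1 (a b : bool) : lin L (vec3 a%:R b%:R 1) 2 = 1.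
  have := QB a b; rewrite m1 mul1r /qf (linB a b true) (linB a b true) (linB a b true).
  rewrite qform_bits; case: (_ (+) _) => //.
  by case: (_ || _) => /eqP; rewrite eq_sym ?(negPf l_neq0) ?(negPf l_neq1).
have /choice[s sE] : forall k, exists j, lin L (aff_pt k) =1 aff_pt j.
  move=> k; have [a [b e]] : exists a b : bool, lin L (aff_pt k) =1 vec3 a%:R b%:R 1.
    do 2!eexists; elim/ord3P; [exact: (linB _ _ true) | exact: (linB _ _ true) | exact: z1].
  by have [j jE] := ptP a b; exists j => i; rewrite e jE.
have s_inj : injective s.
  move=> i j sij; pose a := odd i (+) odd j; pose b := (1 < i)%N (+) (1 < j)%N.
  (* If the points i and j have the same image, L kills their difference (a, b, 0), so F(wa, wb, 1)
     = F(0, 0, 1). As w^2 + w = 1, these values differ by 1 unless a = b = 0. *)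
  have : qf (lin L (vec3 (w * a%:R) (w * b%:R) 1)) = qf (lin L (aff_pt 0)).
    have e k : lin L (vec3 (w * a%:R) (w * b%:R) 1) k = lin L (aff_pt 0) k.
      have := sE j k; rewrite -sij -sE => ij.
      have -> : lin L (aff_pt 0) k
          = lin L (aff_pt 0) k + w * (lin L (aff_pt i) k + lin L (aff_pt j) k).
        by rewrite ij -mulr2n -mulr_natl c2 mul0r mulr0 addr0.
      by apply: (eq2 charK); rewrite /lin !sum3 /aff_pt /vec3 /= !addb_natr; ring2 c2.
    by rewrite /qf !e.
  have -> : aff_pt 0 = vec3 (0 * w) (0 * w) 1 by rewrite mul0r.
  rewrite !Q m1 !mul1r => /eqP.
  have qw (x y : K) : qform l (w * x) (w * y) 1
      = (w ^+ 2 * x ^+ 2 + w * x) ^+ 2 + (w ^+ 2 * x ^+ 2 + w * x) * (w ^+ 2 * y ^+ 2 + w * y)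
        + (w ^+ 2 * y ^+ 2 + w * y) ^+ 2 + l.
    by rewrite /qform; ring.
  rewrite -subr_eq0 !mul0r.
  have -> : qform l (w * a%:R) (w * b%:R) 1 - qform l 0 0 1 = (a || b)%:R.
    apply: (eq2 charK); rewrite qw; case: (a) (b) => [] [] /=;
      rewrite ?mulr1n ?mulr0n ?expr1n ?expr0n /= ?mulr1 ?mulr0 ?addr0 ?w2 /qform; ring2 c2.
  case: (boolP (a || b)) => [_|]; first by rewrite oner_eq0.
  rewrite negb_or !negb_add => /andP[/eqP oij /eqP tij] _.
  apply: val_inj; move: oij tij {sij a b}.
  by case: i j => [[|[|[|[|//]]]] i4] [[|[|[|[|//]]]] j4].
by exists (perm s_inj) => k i; rewrite permE sE.
Qed.

End LinearGroup.

(** * The action of the symmetric group *)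

Section SymmetricGroup.
Variables (K : closedFieldType) (l : K).
Hypothesis charK : 2%N \in [pchar K].
Hypothesis l_neq0 : l != 0.
Hypothesis l_neq1 : l != 1.

Local Notation F := (quartic l).
Local Notation C := (plane_curve F).

Let c2 : 2 = 0 :> K := two_eq0 charK.
Local Notation pt := (aff_pt K).

(* The columns are dictated by the images of [pt 0], [pt 1] and [pt 2]; the image
   of [pt 3] is then right because of [sum_pt]. *)
Definition affL (s : 'S_4) : 'I_3 -> 'I_3 -> K := fun i =>
  vec3 (pt (s 1) i + pt (s 0) i) (pt (s 2) i + pt (s 0) i) (pt (s 0) i).

Lemma sum_pt i : \sum_k pt k i = 0.
Proof.
rewrite !big_ord_recl big_ord0; elim/ord3P: i; rewrite /aff_pt /vec3 /=;
  rewrite ?mulr1n ?mulr0n; ring2 c2.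
Qed.

(** In characteristic 2, x, y and x + y + z are the coordinates of [v] in the basis [pt 1], [pt 2],
    [pt 0]. *)
Lemma affLE s v i : lin (affL s) v i
  = v 0 * pt (s 1) i + v 1 * pt (s 2) i + (v 0 + v 1 + v 2) * pt (s 0) i.
Proof. by rewrite /lin sum3 /affL /vec3 /=; ring. Qed.

Lemma affL_pt s k : lin (affL s) (pt k) =1 pt (s k).
Proof.
move=> i; have : \sum_k pt (s k) i = 0.
  by rewrite -[RHS](sum_pt i) [RHS](reindex_inj (@perm_inj _ s)).
rewrite affLE !big_ord_recl big_ord0 addr0.
have -> : lift ord0 ord0 = 1 :> 'I_4 by apply: val_inj.
have -> : lift ord0 (lift ord0 ord0) = 2 :> 'I_4 by apply: val_inj.
have -> : lift ord0 (lift ord0 (lift ord0 ord0)) = 3 :> 'I_4 by apply: val_inj.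
have -> : ord0 = 0 :> 'I_4 by [].
have [p0 p1 p2] : [/\ pt k 0 = (odd k)%:R, pt k 1 = (1 < k)%N%:R & pt k 2 = 1] by [].
rewrite p0 p1 p2 => S0; apply: (eq2 charK).
have [->|->|->|->] : [\/ k = 0, k = 1, k = 2 | k = 3].
  case: k {p0 p1 p2} => [[|[|[|[|//]]]] k4];
    [constructor 1|constructor 2|constructor 3|constructor 4]; exact: val_inj.
- by rewrite /= ?mulr0n ?mulr1n; ring2 c2.
- by rewrite /= ?mulr0n ?mulr1n; ring2 c2.
- by rewrite /= ?mulr0n ?mulr1n; ring2 c2.
by rewrite -[RHS]S0 /= ?mulr0n ?mulr1n; apply: (eq2 charK); ring2 c2.
Qed.

Lemma affL_comp s t v : lin (affL s) (lin (affL t) v) =1 lin (affL (t * s)%g) v.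
Proof.
move=> i; rewrite [RHS]affLE !permM -!affL_pt.
by rewrite !(lin3 (affL s)) !(affLE t); ring.
Qed.

Lemma affL1 v : lin (affL 1%g) v =1 v.
Proof.
move=> i; rewrite affLE !perm1; apply: (eq2 charK).
by elim/ord3P: i; rewrite /aff_pt /vec3 /= ?mulr1n ?mulr0n; ring2 c2.
Qed.

Lemma affL_z s v : lin (affL s) v 2 = v 2.
Proof. by rewrite affLE /aff_pt /vec3 /= !mulr1; apply: (eq2 charK); ring2 c2. Qed.

(** For fixed z, the map x -> x^2 + xz is F_2-linear in characteristic 2 and kills z. *)
Lemma artin_schreier_bits (a b c : bool) (x y z : K) :
  (x * a%:R + y * b%:R + z * c%:R) ^+ 2 + (x * a%:R + y * b%:R + z * c%:R) * z
  = a%:R * (x ^+ 2 + x * z) + b%:R * (y ^+ 2 + y * z).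
Proof.
by apply: (eq2 charK); case: a b c => [] [] [] /=; rewrite ?mulr1n ?mulr0n; ring2 c2.
Qed.

(** The matrix acting on (X^2 + XZ, Y^2 + YZ) is formed by the differences of the points [s 1] and
    [s 2] from [s 0]. It is invertible, as three distinct points of the affine plane over F_2 are
    not collinear, and u^2 + uv + v^2 is invariant under GL_2(F_2). *)
Lemma affL_qf s v : qf l (lin (affL s) v) = qf l v.
Proof.
rewrite /qf affL_z.
have E0 : lin (affL s) v 0 = v 0 * (odd (s 1) (+) odd (s 0))%:R
    + v 1 * (odd (s 2) (+) odd (s 0))%:R + v 2 * (odd (s 0))%:R.
  by rewrite affLE !(addb_natr charK) /aff_pt /vec3 /=; ring.
have E1 : lin (affL s) v 1 = v 0 * ((1 < s 1%R)%N (+) (1 < s 0%R)%N)%:R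
    + v 1 * ((1 < s 2%R)%N (+) (1 < s 0%R)%N)%:R + v 2 * (1 < s 0%R)%N%:R.
  by rewrite affLE !(addb_natr charK) /aff_pt /vec3 /=; ring.
rewrite E0 E1 /qform !artin_schreier_bits.
have n01 : s 0 != s 1 by rewrite (inj_eq perm_inj).
have n02 : s 0 != s 2 by rewrite (inj_eq perm_inj).
have n12 : s 1 != s 2 by rewrite (inj_eq perm_inj).
apply: (eq2 charK); move: (s 0) (s 1) (s 2) n01 n02 n12.
by case=> [[|[|[|[|//]]]] i4] [[|[|[|[|//]]]] j4] [[|[|[|[|//]]]] k4] //= _ _ _;
  rewrite ?mulr1n ?mulr0n; ring2 c2.
Qed.

Lemma affL_cone s v : on_cone l v -> on_cone l (lin (affL s) v).
Proof.
move=> [v0 Fv]; split; last first.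
  by rewrite quarticE -[LHS]/(qf l _) affL_qf /qf -quarticE.
apply: contrapT => n0; have z i : lin (affL s) v i = 0.
  by apply/eqP/negPn/negP => vi; apply: n0; exists i.
case: v0 => i; rewrite -affL1 -(mulgV s) -affL_comp lin3 !z.
by rewrite !mulr0 !addr0 eqxx.
Qed.

Lemma rep_regular (f : C -> C) L : rep f 0 1 1 (linG L) -> is_regular f.
Proof.
move=> [h1 hL fE] p; exists 0%N, 1%N, 1, (linG L); split=> //.
by rewrite meval1 oner_neq0.
Qed.

Lemma rep_linear_line (f : C -> C) L v (p : C) : rep f 0 1 1 (linG L) ->
  line_of (val p) = <[\row_i v i]>%VS ->
  line_of (val (f p)) = <[\row_i lin L v i]>%VS.
Proof.
move=> rL pv; rewrite (rep_line rL pv) ?meval1 ?oner_neq0 //.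
by congr <[_]>%VS; apply/rowP => i; rewrite !mxE meval_linG.
Qed.

Lemma point_inj (p q : C) : line_of (val p) = line_of (val q) -> p = q.
Proof. by move=> pq; do 2!apply: val_inj. Qed.

Lemma line_hcoord (p : C) : line_of (val p) = <[\row_i hcoord (val p) i]>%VS.
Proof. by rewrite line_ofE; congr <[_]>%VS; apply/rowP => i; rewrite mxE. Qed.

Lemma act_exists s : exists f : C -> C, rep f 0 1 1 (linG (affL s)).
Proof.
have /choice[f fP] : forall p : C, exists q : C,
    line_of (val q) = <[\row_i lin (affL s) (hcoord (val p)) i]>%VS.
  by move=> p; apply/cone_point/affL_cone/on_cone_hcoord.
exists f; split; [exact: dhomog1 | exact: linG_homog | move=> q _].
by rewrite fP; congr <[_]>%VS; apply/rowP => i; rewrite !mxE meval_linG.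
Qed.

Definition act s : C -> C := projT1 (cid (act_exists s)).

Lemma act_rep s : rep (act s) 0 1 1 (linG (affL s)).
Proof. exact: projT2 (cid (act_exists s)). Qed.

Lemma act_comp s t p : act s (act t p) = act (t * s)%g p.
Proof.
apply: point_inj.
rewrite (rep_linear_line (act_rep s) (rep_linear_line (act_rep t) (line_hcoord p))).
rewrite (rep_linear_line (act_rep _) (line_hcoord p)).
by congr <[_]>%VS; apply/rowP => i; rewrite !mxE affL_comp.
Qed.

Lemma act1 p : act 1%g p = p.
Proof.
apply: point_inj; rewrite (rep_linear_line (act_rep _) (line_hcoord p)).
by rewrite [RHS]line_hcoord; congr <[_]>%VS; apply/rowP => i; rewrite !mxE affL1.
Qed.

Lemma act_automorphism s : is_automorphism (act s).
Proof.
split; first exact: rep_regular (act_rep s).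
exists (act s^-1%g); split; first exact: rep_regular (act_rep _).
- by move=> p; rewrite act_comp mulgV act1.
- by move=> p; rewrite act_comp mulVg act1.
Qed.

(** At each point of the curve the two matrices give proportional vectors. Both preserve Z, so the
    factor is 1 where Z = 1. The difference then gives polynomials of degree at most 1 that vanish
    on the chart, so the matrices coincide. *)
Lemma act_inj s t : act s =1 act t -> s = t.
Proof.
move=> st; pose d k i := affL s i k - affL t i k.
pose a0 i := Poly [:: d 2 i; d 1 i]; pose a1 i := Poly [:: d 0 i].
have d0 i : Poly [:: a0 i; a1 i] = 0.
  apply: (chart1_van (l := l) charK) => [|x y xy].
    by apply: leq_trans (size_Poly _) _.
  have cv : on_cone l (vec3 x y 1).
    by split; [exists 2; exact: oner_neq0 | rewrite quarticE].
  have [p pv] := cone_point cv.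
  have [||c _ cE] := @vline_row_inj _ (lin (affL s) (vec3 x y 1)) (lin (affL t) (vec3 x y 1)).
  - by case: (affL_cone s cv).
  - by rewrite -(rep_linear_line (act_rep s) pv) -(rep_linear_line (act_rep t) pv) st.
  have c1 : c = 1 by have := cE 2; rewrite !affL_z /vec3 /= mulr1 => ->.
  have := cE i; rewrite c1 mul1r !lin3 /vec3 /= => e.
  rewrite /= !(horner_cons, hornerD, hornerM, hornerC) /a0 /a1 /= ?(horner_cons, hornerC) /d.
  transitivity (affL s i 0 * x + affL s i 1 * y + affL s i 2 * 1
      - (affL t i 0 * x + affL t i 1 * y + affL t i 2 * 1)); first by ring.
  by rewrite e subrr.
have sE i k : affL s i k = affL t i k.
  have e0 := congr1 (fun P : {poly {poly K}} => P`_0) (d0 i).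
  have e1 := congr1 (fun P : {poly {poly K}} => P`_1) (d0 i).
  rewrite !coef_Poly !coef0 /= in e0 e1.
  have f0 := congr1 (fun P : {poly K} => P`_0) e0.
  have f1 := congr1 (fun P : {poly K} => P`_1) e0.
  have f2 := congr1 (fun P : {poly K} => P`_0) e1.
  rewrite !coef_Poly !coef0 /= in f0 f1 f2.
  by apply/eqP; rewrite -subr_eq0; apply/eqP; elim/ord3P: k.
have pt_inj a b : pt a =1 pt b -> a = b.
  move=> ab; apply: val_inj; have := ab 0; have := ab 1; rewrite /aff_pt /vec3 /=.
  case: a b {ab} => [[|[|[|[|//]]]] i4] [[|[|[|[|//]]]] j4] //= /eqP + /eqP;
    by rewrite ?mulr1n ?mulr0n ?eqxx ?oner_eq0 // 1?eq_sym ?oner_eq0.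
apply/permP => k; apply: pt_inj => i; rewrite -!affL_pt /lin.
by apply: eq_bigr => j _; rewrite sE.
Qed.

Lemma act_surj (f : curve_aut F) : exists s, f =1 act s.
Proof.
have [r_f [g [r_g fK gK]]] := autP f.
have [L LP] := regular_linear charK l_neq0 r_f.
have rL := linear_rep charK l_neq0 r_g fK LP.
have L_cone v : on_cone l v -> on_cone l (lin L v).
  move=> cv; have [p pv] := cone_point cv.
  exact: point_on_cone (rep_linear_line rL pv).
have L_idem := linear_idempotent charK l_neq0 r_g fK LP.
have [s sE] := affine_perm charK l_neq0 l_neq1 L_cone L_idem.
exists s => p; apply: point_inj.
rewrite (rep_linear_line rL (line_hcoord p)) (rep_linear_line (act_rep s) (line_hcoord p)).
(* The two matrices agree at [pt 0], [pt 1] and [pt 2], which form a basis. *)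
congr <[_]>%VS; apply/rowP => i; rewrite !mxE affLE -!sE !lin3.
by rewrite /aff_pt /vec3 /= ?mulr0n ?mulr1n; apply: (eq2 charK); ring2 c2.
Qed.

(* The inverse is due to permutations being multiplied from left to right. *)
Definition act_aut s : curve_aut F := mkaut (act_automorphism s^-1%g).

Lemma act_autM s t : act_aut (s * t)%g = (act_aut s * act_aut t)%g.
Proof. by apply: aut_inj => p /=; rewrite act_comp invMg. Qed.

Lemma act_aut_bij : exists g : curve_aut F -> 'S_4, cancel g act_aut /\ cancel act_aut g.
Proof.
have /choice[g gP] : forall f : curve_aut F, exists s, act_aut s = f.
  move=> f; have [s fs] := act_surj f; exists s^-1%g.
  by apply: aut_inj => p /=; rewrite invgK fs.
exists g; split=> // s; apply: invg_inj; apply: act_inj => p.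
by have := congr1 (fun f : curve_aut F => f p) (gP (act_aut s)).
Qed.

End SymmetricGroup.

(** * The isomorphism with S_4 and the order of the group *)

Local Open Scope classical_set_scope.
Local Open Scope ring_scope.

Theorem theorem2 (K : closedFieldType) (l : K)
    (charK : 2%N \in [pchar K]) (l_neq0 : l != 0) (l_neq1 : l != 1) :
  (exists f : {multiplicative curve_aut (quartic l) -> 'S_4}, bijective f) /\
  ([set: curve_aut (quartic l)] #= `I_24)%card.
Proof.
have [g [gK actK]] := act_aut_bij charK l_neq0 l_neq1.
have gM : {morph g : x y / (x * y)%g >-> (x * y)%g}.
  by move=> x y; apply: (can_inj actK); rewrite act_autM !gK.
have g_bij : bijective g by exists (act_aut l charK).
split.
  pose m := isMultiplicative.Build _ _ g gM.
  pose f : {multiplicative curve_aut (quartic l) -> 'S_4} := HB.pack g m.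
  by exists f.
pose h (i : 'I_#|'S_4|) := act_aut l charK (enum_val i).
have -> : [set: curve_aut (quartic l)] = h @` [set: 'I_#|'S_4|].
  apply/esym/seteqP; split=> // f _; exists (enum_rank (g f)) => //.
  by rewrite /h enum_rankK gK.
apply: card_eq_trans (inj_card_eq _) _.
  by move=> i j _ _ /(can_inj actK)/enum_val_inj.
by rewrite card_Sn card_eq_sym; exact: card_II.
Qed.
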